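(* Let $X$ be a compact metric space and let $f:X\to X$ be a continuous map with finite topological entropy whose entropy map $\mu\mapsto h_\mu(f)$ is upper semi-continuous on the space $\mathcal M$ of $f$-invariant Borel probability measures. Let $m\in\mathbb N$, let $\Phi:X\to\mathbb R^m$ be continuous, and let $\alpha\in S^{m-1}$. Then: (a) If $\mu\in GS(\alpha)$, then $\mathrm{rv}(\mu)\in F_\alpha(\Phi)$ and $h_\mu(f)=\sup\{h_\nu(f):\nu\in\mathcal M,\ \mathrm{rv}(\nu)\in F_\alpha(\Phi)\}$. (b) The set $\{\mathrm{rv}(\mu):\mu\in GS(\alpha)\}$ is compact. Further, if for all large enough $t$ the potential $t\,\alpha\cdot\Phi$ has a unique equilibrium state $\mu_t$ and the map $t\mapsto \mathrm{rv}(\mu_t)$ is continuous, then $\{\mathrm{rv}(\mu):\mu\in GS(\alpha)\}$ is connected.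
   Context: $\mathcal M$ carries the weak$^*$ topology and $h_\mu(f)$ is the measure-theoretic entropy. An equilibrium state of a continuous $\varphi:X\to\mathbb R$ is a $\mu\in\mathcal M$ maximizing $h_\nu(f)+\int\varphi\,d\nu$ over $\nu\in\mathcal M$; $ES(\varphi)$ is the set of these. A ground state of $\varphi$ is a $\mu\in\mathcal M$ for which there are an increasing sequence $t_n\to\infty$ and $\mu_{t_n}\in ES(t_n\varphi)$ with $\mu_{t_n}\to\mu$ weak$^*$. For $\Phi=(\phi_1,\dots,\phi_m)$ continuous, $\mathrm{rv}(\mu)=(\int\phi_1\,d\mu,\dots,\int\phi_m\,d\mu)$, and the rotation set is $\mathrm{Rot}(\Phi)=\{\mathrm{rv}(\mu):\mu\in\mathcal M\}$, a compact convex subset of $\mathbb R^m$. Elements $\alpha\in S^{m-1}=\{\alpha\in\mathbb R^m:\|\alpha\|=1\}$ are called direction vectors; $\alpha\cdot\Phi=\sum_i\alpha_i\phi_i$; $GS(\alpha)$ is the set of ground states of $\alpha\cdot\Phi$. $H_\alpha(\Phi)$ is the supporting hyperplane of $\mathrm{Rot}(\Phi)$ with normal vector $\alpha$ pointing away from $\mathrm{Rot}(\Phi)$, i.e. $H_\alpha(\Phi)=\{u\in\mathbb R^m:\alpha\cdot u=\max_{w\in\mathrm{Rot}(\Phi)}\alpha\cdot w\}$, and $F_\alpha(\Phi)=\mathrm{Rot}(\Phi)\cap H_\alpha(\Phi)$ is the associated face. *)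

(* Defs.v *)
From HB Require Import structures.
From mathcomp Require Import all_boot all_order all_algebra.
From mathcomp Require Import all_classical all_reals all_analysis.

Set Implicit Arguments.
Unset Strict Implicit.
Unset Printing Implicit Defensive.

Import Order.TTheory GRing.Theory Num.Theory.
Import numFieldNormedType.Exports.

Local Open Scope classical_set_scope.
Local Open Scope ring_scope.

(* Measurable types are pointed in the library, so the phase space has to be a
   nonempty metric space; the distinguished point plays no other role. *)
#[short(type="pmetricType")]
HB.structure Definition PointedMetric (K : numDomainType) :=
  {T of Metric K T & Pointed T}.

Notation borel X := (g_sigma_algebraType (@open X)).

Section WeakStar.
Context {R : realType} (X : pmetricType R).

Definition integrals (mu : probability (borel X) R) :
  {ptws continuousType X R -> R} :=
  fun phi => \int[mu]_x phi x.

(* The weak* topology: the coarsest one for which mu |-> \int phi dmu is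
   continuous for every continuous phi : X -> R. *)
HB.instance Definition _ :=
  Topological.copy (probability (borel X) R) (initial_topology integrals).

End WeakStar.

Section Dynamics.
Context {R : realType} {X : pmetricType R}.
Implicit Types (f : X -> X) (mu nu : probability (borel X) R) (phi : X -> R).

Definition invariant_measures f : set (probability (borel X) R) :=
  [set mu | forall A : set (borel X), measurable A -> mu (f @^-1` A) = mu A].

(* Blocks of a partition may be empty; they contribute 0 * ln 0 = 0 below. *)
Definition measurable_partition (I : finType) (P : I -> set (borel X)) : Prop :=
  [/\ forall i, measurable (P i), trivIset [set: I] P
    & \bigcup_i P i = [set: borel X]].

Definition partition_entropy mu (I : finType) (P : I -> set (borel X)) : R :=
  - \sum_(i : I) fine (mu (P i)) * ln (fine (mu (P i))).

(* The join of the partitions f^{-i} P for i < n, indexed by words. *)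
Definition iterated_join f k (P : 'I_k -> set (borel X)) (n : nat)
    (w : {ffun 'I_n -> 'I_k}) : set (borel X) :=
  [set x | forall i : 'I_n, P (w i) (iter i f x)].

Definition entropy_of_partition f mu k (P : 'I_k -> set (borel X)) : \bar R :=
  limn (fun n => (partition_entropy mu (@iterated_join f k P n) / n%:R)%:E).

Definition ks_entropy f mu : \bar R :=
  ereal_sup [set h | exists k, exists P : 'I_k -> set (borel X),
    measurable_partition P /\ h = entropy_of_partition f mu P].

Definition bowen_dist f (n : nat) (x y : X) : R :=
  \big[Num.max/0]_(i < n) mdist (iter i f x) (iter i f y).

Definition separated f (n : nat) (e : R) (s : seq X) : Prop :=
  uniq s /\ forall x y, x \in s -> y \in s -> x != y -> e < bowen_dist f n x y.

Definition separated_card f (n : nat) (e : R) : \bar R :=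
  ereal_sup [set ((size s)%:R)%:E | s in separated f n e].

(* Here 0^-1 = 0, so the spurious n = 0 term is harmless. *)
Definition topological_entropy f : \bar R :=
  lim (limn_esup (fun n => ((n%:R)^-1)%:E * lne (separated_card f n e))%E
        @[e --> 0^'+]).

Definition usc_entropy_map f : Prop :=
  forall mu, invariant_measures f mu -> forall a : R,
    (ks_entropy f mu < a%:E)%E ->
    \forall nu \near within (invariant_measures f) (nbhs mu),
      (ks_entropy f nu < a%:E)%E.

Definition equilibrium_states f phi : set (probability (borel X) R) :=
  [set mu | invariant_measures f mu /\
    forall nu, invariant_measures f nu ->
      (ks_entropy f nu + (\int[nu]_x phi x)%:E <=
       ks_entropy f mu + (\int[mu]_x phi x)%:E)%E].

(* A term of type probability also carries values on non-measurable sets, so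
   uniqueness is equality on all Borel sets rather than Leibniz equality. *)
Definition unique_equilibrium_state f phi mu : Prop :=
  equilibrium_states f phi mu /\
  forall nu, equilibrium_states f phi nu ->
    forall A : set (borel X), measurable A -> nu A = mu A.

Definition ground_states f phi : set (probability (borel X) R) :=
  [set mu | invariant_measures f mu /\
    exists (t : nat -> R) (mu_ : nat -> probability (borel X) R),
      [/\ increasing_seq t, t @ \oo --> +oo,
          forall n, equilibrium_states f (fun x => t n * phi x) (mu_ n)
        & mu_ @ \oo --> mu]].

Context {m : nat}.
Implicit Types (alpha u w : 'rV[R]_m) (Phi : X -> 'rV[R]_m).

Definition dot alpha u : R := \sum_(i < m) alpha 0 i * u 0 i.

(* The library's norm on row vectors is the sup norm, hence the explicit
   Euclidean norm. *)
Definition unit_sphere : set 'rV[R]_m :=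
  [set alpha | Num.sqrt (dot alpha alpha) = 1].

Definition rv Phi mu : 'rV[R]_m := \row_(i < m) \int[mu]_x Phi x 0 i.

Definition rotation_set f Phi : set 'rV[R]_m :=
  [set rv Phi mu | mu in invariant_measures f].

Definition is_max (A : set R) (c : R) : Prop := A c /\ ubound A c.

Definition supporting_hyperplane f Phi alpha : set 'rV[R]_m :=
  [set u | is_max [set dot alpha w | w in rotation_set f Phi] (dot alpha u)].

Definition face f Phi alpha : set 'rV[R]_m :=
  rotation_set f Phi `&` supporting_hyperplane f Phi alpha.

Definition direction_potential alpha Phi : X -> R := fun x => dot alpha (Phi x).

Definition GS f Phi alpha : set (probability (borel X) R) :=
  ground_states f (direction_potential alpha Phi).

End Dynamics.

Arguments unit_sphere {R m}.

(* Main.v *)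
(** If [mu_n] is an equilibrium state of [t_n (alpha . Phi)] and [mu_n] tends to
    [mu], comparing [mu_n] with an invariant [nu] and dividing by [t_n] shows that
    [mu] maximizes the integral of [alpha . Phi], because entropies are bounded;
    if [nu] is itself maximizing, the comparison gives [h(nu) <= h(mu_n)], and
    upper semi-continuity gives [h(nu) <= h(mu)].

    Entropies are bounded by the topological entropy plus [ln 2 + 1], after
    Misiurewicz: a partition is replaced by disjoint closed subsets of its blocks,
    so that a Bowen ball determines the itineraries of its points up to the rare
    visits to the rest of the space.  The conditional entropies of the usual proof
    are avoided by testing the Gibbs inequality against an explicit vector.

    The rotation vectors of ground states are exactly the limits of rotation
    vectors of equilibrium states of [t (alpha . Phi)] as [t] tends to infinity, by
    sequential compactness of the space of probability measures; a set of such
    limits is closed, and connected when the equilibrium states form a continuous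
    curve.  Sequential compactness is obtained without the Riesz representation
    theorem: along a subsequence the measures of the cells of a refining sequence
    of partitions converge, and the limit measure is the image of Lebesgue measure
    on [0, 1[ under the map coding nested intervals by nested cells. *)

Require Import Defs.
From HB Require Import structures.
From mathcomp Require Import all_boot all_order all_algebra.
From mathcomp Require Import all_classical all_reals all_analysis.
From mathcomp Require Import measurable_realfun.
From mathcomp Require Import lra.

Set Implicit Arguments.
Unset Strict Implicit.
Unset Printing Implicit Defensive.

Import Order.TTheory GRing.Theory Num.Theory.
Import numFieldNormedType.Exports.

Local Open Scope classical_set_scope.
Local Open Scope ring_scope.

(** * Distance to a set and Borel measurability *)

Section DistanceToSet.
Context {R : realType} {X : pmetricType R}.
Implicit Types (C : set X) (x y : X).

(** The infimum of the empty set is 0 by default, so the distance to [set0] vanishes and positivity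
    off a closed set requires a point in [C]. *)
Definition infd C x : R := inf [set mdist x c | c in C].

Let infd_set_lb C x : has_lbound [set mdist x c | c in C].
Proof. by exists 0 => _ [c _ <-]; exact: mdist_ge0. Qed.

Lemma infd_le C x c : C c -> infd C x <= mdist x c.
Proof. by move=> Cc; apply: ge_inf => //; exists c. Qed.

Lemma infd_ge0 C x : 0 <= infd C x.
Proof.
have [->|/set0P[c Cc]] := eqVneq C set0; first by rewrite /infd image_set0 inf0.
apply: lb_le_inf; first by exists (mdist x c), c.
by move=> _ [d _ <-]; exact: mdist_ge0.
Qed.

Lemma infd_lip C x y : infd C x <= infd C y + mdist x y.
Proof.
have [->|/set0P[c Cc]] := eqVneq C set0.
  by rewrite /infd !image_set0 inf0 add0r mdist_ge0.
rewrite -lerBlDr; apply: lb_le_inf; first by exists (mdist y c), c.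
move=> _ [d Cd <-]; rewrite lerBlDr addrC.
exact: le_trans (infd_le _ Cd) (metric_triangle _ _ _).
Qed.

Lemma infd_continuous C : continuous (infd C).
Proof.
move=> x; apply/cvgrPdist_lt => e e0.
near=> y.
have xy : mdist x y < e.
  have : ball x e y by near: y; exact: nbhsx_ballx.
  by rewrite ballEmdist.
have := infd_lip C x y; have := infd_lip C y x; rewrite (metric_sym y x) => h1 h2.
by rewrite ltr_norml; apply/andP; split; lra.
Unshelve. all: by end_near. Qed.

Lemma infd_gt0 C x : closed C -> C !=set0 -> ~ C x -> 0 < infd C x.
Proof.
move=> cC [c Cc] nCx.
have /nbhs_ballP[e /= e0 eC] : nbhs x (~` C).
  by apply: open_nbhs_nbhs; split => //; exact: closed_openC.
apply: (lt_le_trans e0); apply: lb_le_inf; first by exists (mdist x c), c.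
move=> _ [d Cd <-]; rewrite leNgt; apply/negP => xd.
by have := eC d; rewrite ballEmdist/= => /(_ xd).
Qed.

Lemma infd_eq0 C x : C x -> infd C x = 0.
Proof.
move=> Cx; apply/eqP; rewrite eq_le infd_ge0 andbT.
by rewrite -(mdistxx x); exact: infd_le.
Qed.

Lemma closed_infdE C : closed C -> C !=set0 -> C = [set x | infd C x = 0].
Proof.
move=> cC C0; apply/seteqP; split=> [x|x /= x0]; first exact: infd_eq0.
apply: contrapT => nCx.
by have := infd_gt0 cC C0 nCx; rewrite x0 ltxx.
Qed.

End DistanceToSet.

Section BorelMeasurability.
Context {R : realType} {X : pmetricType R}.

Lemma open_borel (U : set X) : open U -> measurable (U : set (borel X)).
Proof. by move=> oU; exact: sub_sigma_algebra. Qed.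

Lemma closed_borel (C : set X) : closed C -> measurable (C : set (borel X)).
Proof.
move=> cC; rewrite -[C]setCK; apply: measurableC.
by apply: open_borel; exact: closed_openC.
Qed.

Lemma continuous_borel (g : X -> R) : continuous g ->
  measurable_fun [set: borel X] (g : borel X -> R).
Proof.
move=> /continuousP cg _.
apply: (measurability _ (RGenOpens.measurableE R)) => //.
move=> _ [_ [a [b ->]] <-]; rewrite setTI; apply: open_borel; apply: cg.
exact: interval_open.
Qed.

Lemma borel_measurable_fun d (T : measurableType d) (h : T -> X) :
  (forall U : set X, open U -> measurable (h @^-1` U)) ->
  measurable_fun setT (h : T -> borel X).
Proof.
move=> mh _; apply: (@measurability _ _ T (borel X) setT h (@open X) erefl _ measurableT).
move=> _ [U oU <-].
by rewrite setTI; exact: mh.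
Qed.

Lemma continuous_borel_map (f : X -> X) : continuous f ->
  measurable_fun [set: borel X] (f : borel X -> borel X).
Proof.
move=> /continuousP cf; apply: borel_measurable_fun => U oU.
by apply: open_borel; exact: cf.
Qed.

(** An open set is the locus where the distance to its complement is nonzero, so real test functions
    detect Borel measurability. This form suits a pointwise limit of maps, whose compositions with
    test functions are limits of real functions. *)
Lemma borel_measurable_fun_continuous d (T : measurableType d) (h : T -> X) :
  (forall g : X -> R, continuous g -> measurable_fun setT (g \o h)) ->
  measurable_fun setT (h : T -> borel X).
Proof.
move=> mh; apply: borel_measurable_fun => U oU.
have [UT|/set0P CU] := eqVneq (~` U) set0.
  have -> : U = setT by rewrite -[U]setCK UT setC0.
  by rewrite preimage_setT.
have cU : closed (~` U) by exact: open_closedC.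
have := mh _ (@infd_continuous _ _ (~` U)) measurableT _
  (measurableC (measurable_set1 (0 : R))).
rewrite setTI => h0; congr (measurable _): h0.
by rewrite -[in RHS](setCK U) [in X in _ = h @^-1` (~` X)](closed_infdE cU CU).

Qed.

End BorelMeasurability.

(** * Continuous functions on a compact space and their integrals *)

Section CompactSpace.
Context {R : realType} {X : pmetricType R}.
Hypothesis cptX : compact [set: X].
Implicit Types (mu nu : probability (borel X) R) (g : X -> R).

Lemma continuous_bounded g : continuous g -> exists M, forall x, `|g x| <= M.
Proof.
move=> cg.
have /compact_bounded[M [_ /(_ (M + 1))]] : compact (g @` setT).
  by apply: continuous_compact => //; apply: continuous_subspaceT.
rewrite ltrDl ltr01 => /(_ isT) h; exists (M + 1) => x.
by apply: h; exists x.
Qed.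

Lemma continuous_integrable mu g : continuous g ->
  mu.-integrable [set: borel X] (EFin \o g).
Proof.
move=> cg; apply: measurable_bounded_integrable => //.
- by rewrite (le_lt_trans (probability_le1 mu _)) ?ltry.
- exact: continuous_borel.
- have [M gM] := continuous_bounded cg.
  exists M; split; first exact: num_real.
  by move=> N /ltW MN x _; exact: le_trans (gM x) MN.
Qed.

(** Heine's theorem through the near-covering form of compactness: radii that work near each point
    yield one that works everywhere. *)
Lemma continuous_uniform g (e : R) : continuous g -> 0 < e ->
  exists2 d, 0 < d & forall x y, mdist x y < d -> `|g x - g y| < e.
Proof.
move=> cg e0.
have := cptX; rewrite compact_near_coveringP => Hc.
have hnear : forall x : X, setT x -> \forall x' \near x & d \near (0 : R)^'+,
    (forall y, mdist x' y < d -> `|g x' - g y| < e).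
  move=> x _.
  have /cvgrPdist_lt /(_ (e / 2)) := cg x.
  rewrite divr_gt0// => /(_ isT) /nbhs_ballP[d /= d0 dg].
  exists (ball x (d / 2), [set t | t < d / 2]) => /=.
    split; first by apply: nbhsx_ballx; rewrite divr_gt0.
    by apply: nbhs_right_lt; rewrite divr_gt0.
  move=> [x' t] /= [xx' td] y x'y.
  have h1 : `|g x - g x'| < e / 2.
    by apply: dg; apply: le_ball xx'; rewrite ler_pdivrMr// ler_pMr// ler1n.
  have h2 : `|g x - g y| < e / 2.
    apply: dg; rewrite [d]splitr; apply: ball_triangle xx' _.
    by rewrite ballEmdist/=; exact: lt_trans td.
  rewrite [e]splitr -[_ - _](subrKA (g x)) (le_lt_trans (ler_normD _ _))//.
  by rewrite ltrD// distrC.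
have H := Hc _ _ _ (at_right_proper_filter (0 : R)) hnear.
near (0 : R)^'+ => d; exists d; first by near: d; exact: nbhs_right_gt.
move=> x y; suff : [set: X] `<=` (fun x => forall y, mdist x y < d -> `|g x - g y| < e).
  by move/(_ x I); exact.
by near: d.
Unshelve. all: by end_near. Qed.

Lemma Rintegral_le_sup mu g M : continuous g -> (forall x, g x <= M) ->
  \int[mu]_x g x <= M.
Proof.
move=> cg gM; have -> : M = \int[mu]_(x in [set: borel X]) M.
  rewrite Rintegral_cst//.
by rewrite -[LHS]mulr1 -[X in _ * X = _]/(fine 1) -(probability_setT mu).
apply: le_Rintegral => //; first exact: continuous_integrable.
by apply: continuous_integrable; exact: cst_continuous.
Qed.

Lemma norm_Rintegral_le mu g M : continuous g -> (forall x, `|g x| <= M) ->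
  `|\int[mu]_x g x| <= M.
Proof.
move=> cg gM; apply: le_trans (le_normr_Rintegral _ _) _ => //.
  exact: continuous_integrable.
apply: (@Rintegral_le_sup _ (fun x => `|g x|)) => // x.
exact: continuous_comp (cg x) (@norm_continuous _ R _).
Qed.

End CompactSpace.

(** * Regularity of Borel measures *)

Section ClosedRegularity.
Context {R : realType} {X : pmetricType R}.
Variable mu : {measure set (borel X) -> \bar R}.
Hypothesis mu_fin : (mu [set: borel X] < +oo)%E.
Implicit Types (A C U : set (borel X)).

(** Continuity from above along the differences of [A] and [K n], which decrease to the empty
    set. *)
Let measure_small A (K : nat -> set (borel X)) (e : R) :
  measurable A -> (forall n, measurable (K n)) ->
  {homo K : n m / (n <= m)%N >-> n `<=` m} -> A `<=` \bigcup_n K n -> 0 < e ->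
  exists n, (mu (A `\` K n) <= e%:E)%E.
Proof.
move=> mA mK ndK AK e0; pose F n := A `\` K n.
have mF n : measurable (F n) by exact: measurableD.
have F0 : \bigcap_n F n = set0.
  rewrite -subset0 => x Fx; have [Ax _] := Fx 0%N I.
  by have [n _ Kx] := AK x Ax; have [_] := Fx n I.
have : (mu \o F) x @[x --> \oo] --> mu (\bigcap_n F n).
  apply: nonincreasing_cvg_mu => //.
  - by apply: le_lt_trans mu_fin; apply: le_measure => //; rewrite inE.
  - by rewrite F0.
  - by move=> n k nk; apply/subsetPset; apply: setDS; exact: ndK.
rewrite F0 measure0 => /fine_cvgP[Ffin /cvgr0Pnorm_le/(_ e e0) Fe].
near \oo => n; exists n.
have fn : mu (F n) \is a fin_num by near: n.
rewrite -/(F n) -(fineK fn) lee_fin (le_trans (ler_norm _))//.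
by near: n.
Unshelve. all: by end_near. Qed.

Let closed_regular A := forall e : R, 0 < e ->
  exists C U, [/\ closed (C : set X), open (U : set X), C `<=` A, A `<=` U &
    (mu (U `\` C) <= e%:E)%E].

(** An open set is exhausted by the closed sets of points at distance at least 1/(n+1) from its
    complement; the whole space is treated apart, because the distance to the empty set is 0. *)
Let open_regular A : open (A : set X) -> closed_regular A.
Proof.
move=> oA e e0.
have [AT|/set0P CA] := eqVneq (~` A) set0.
  exists A, A; split => //.
    by rewrite -[A]setCK AT setC0; exact: closedT.
  by rewrite setDv measure0 lee_fin ltW.
have cA : closed (~` A : set X) by exact: open_closedC.
pose K n : set (borel X) := [set x | n.+1%:R^-1 <= infd (~` A : set X) x].
have cK n : closed (K n : set X).
  apply: (@preimage_closed _ _ (infd (~` A : set X)) [set r | n.+1%:R^-1 <= r]).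
    by move=> x _; exact: infd_continuous.
  exact: closed_ge.
have [n nK] : exists n, (mu (A `\` K n) <= e%:E)%E.
  apply: measure_small => //.
  - exact: open_borel.
  - by move=> n; exact: closed_borel.
  - move=> n k nk x; rewrite /K /=; apply: le_trans.
    by rewrite lef_pV2 ?posrE// ler_nat.
  - move=> x Ax; have := infd_gt0 cA CA (fun h => h Ax).
    set r := infd _ _ => r0; exists (Num.truncn r^-1) => //.
    by rewrite /K /= -/r invf_ple ?posrE// ltW// truncnS_gt.
exists (K n), A; split => //.
move=> x Kx; apply: contrapT => nAx.
move: Kx; rewrite /K /= infd_eq0//.
by apply/negP; rewrite -ltNge invr_gt0.
Qed.

(** Dynkin induction from the open sets. For a disjoint union the outer sets are united, while the
    union of the inner closed sets is cut to a finite one in order to stay closed. *)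
Lemma measurable_closed_regular A : measurable A -> closed_regular A.
Proof.
move=> mA; suff : <<s (@open X) >> A -> closed_regular A by exact.
apply: (@dynkin_induction _ (borel X) (@open X) closed_regular) => //.
- by move=> B C oB oC; exact: openI.
- exact: open_regular openT.
- move=> B mB rB e /rB[C [U [cC oU CB BU CUe]]]; exists (~` U), (~` C); split.
  + exact: open_closedC.
  + exact: closed_openC.
  + exact: subsetC.
  + exact: subsetC.
  + by rewrite setDE setCK setIC -setDE.
- move=> F mF tF rF e e0.
  have e2 : 0 < e / 2 by rewrite divr_gt0.
  (* The errors [eps n] sum to e/2; the other half pays for truncating the union of the closed
     sets. *)
  pose eps n := e / 2 / (2 ^ n.+1)%:R.
  have eps0 n : 0 < eps n by rewrite divr_gt0// ltr0n expn_gt0.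
  have /choice[CU CUP] : forall n, exists CU : set (borel X) * set (borel X),
      [/\ closed (CU.1 : set X), open (CU.2 : set X), CU.1 `<=` F n,
       F n `<=` CU.2 & (mu (CU.2 `\` CU.1) <= (eps n)%:E)%E].
    by move=> n; have [C [U rCU]] := rF n _ (eps0 n); exists (C, U).
  pose K n : set (borel X) := \big[setU/set0]_(i < n) (CU i).1.
  pose C := \bigcup_n (CU n).1; pose U := \bigcup_n (CU n).2.
  have mC1 n : measurable (CU n).1.
    by apply: closed_borel; have [] := CUP n.
  have mU1 n : measurable (CU n).2.
    by apply: open_borel; have [] := CUP n.
  have mC : measurable C by exact: bigcupT_measurable.
  have mU : measurable U by exact: bigcupT_measurable.
  have cK n : closed (K n : set X).
    by apply: closed_bigsetU => i _; have [] := CUP i.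
  have KC n : K n `<=` C by exact: bigsetU_bigcup.
  have [n Kn] : exists n, (mu (C `\` K n) <= (e / 2)%:E)%E.
    apply: measure_small => //.
    - by move=> n; exact: closed_borel.
    - by move=> n k nk; apply: (@subset_bigsetU _ (fun i => (CU i).1)).
    - move=> x [n _ Cx]; exists n.+1 => //; rewrite /K big_ord_recr/=.
      by right.
  have CF : C `<=` \bigcup_n F n by apply: subset_bigcup => i _; have [] := CUP i.
  exists (K n), U; split => //.
  + by apply: bigcup_open => i _; have [] := CUP i.
  + exact: subset_trans (KC n) CF.
  + by apply: subset_bigcup => i _; have [] := CUP i.
  + have UC : (mu (U `\` C) <= (e / 2)%:E)%E.
      apply: le_trans (epsilon_trick0 xpredT (ltW e2)).
      apply: (@le_trans _ _ (\sum_(0 <= i <oo) mu ((CU i).2 `\` (CU i).1))%E).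
        apply: measure_sigma_subadditive.
        - by move=> i; exact: measurableD.
        - exact: measurableD.
        - move=> x [[i _ Ux] nCx]; exists i => //; split => // Cx.
          by apply: nCx; exists i.
      apply: lee_nneseries => [//|i *].
      by have [] := CUP i.
    apply: (@le_trans _ _ (mu ((U `\` C) `|` (C `\` K n)))).
      apply: le_measure; rewrite ?inE.
      - by apply: measurableD => //; exact: closed_borel.
      - apply: measurableU; apply: measurableD => //; exact: closed_borel.
      - move=> x [Ux nKx]; have [Cx|nCx] := pselect (C x); first by right.
        by left.
    apply: (@le_trans _ _ (mu (U `\` C) + mu (C `\` K n))%E).
      apply: measureU2; apply: measurableD => //.
      exact: closed_borel.
    by rewrite [e in e%:E]splitr EFinD leeD.
Qed.

Lemma closed_inner_regular A (e : R) : measurable A -> 0 < e ->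
  exists C, [/\ closed (C : set X), C `<=` A & (mu (A `\` C) <= e%:E)%E].
Proof.
move=> mA e0; have [C [U [cC oU CA AU CUe]]] := measurable_closed_regular mA e0.
exists C; split => //; apply: le_trans CUe.
apply: le_measure; rewrite ?inE.
- by apply: measurableD => //; exact: closed_borel.
- by apply: measurableD; [exact: open_borel|exact: closed_borel].
- exact: setSD.
Qed.

End ClosedRegularity.

(** The distance to [C] attains its minimum on the compact set [B], and this minimum is positive. *)
Lemma closed_separation (R : realType) (X : pmetricType R) (B C : set X) :
  compact [set: X] -> closed B -> closed C -> B `&` C = set0 ->
  exists2 d : R, 0 < d & forall x y, B x -> C y -> d <= mdist x y.
Proof.
move=> cptX cB cC BC0.
have [->|/set0P C0] := eqVneq C set0; first by exists 1.
have [->|/set0P B0] := eqVneq B set0; first by exists 1.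
have cptB : compact B by apply: subclosed_compact cptX _.
have [z zB zmin] := @compact_EVT_min _ _ (infd C) _ B0 cptB
  (continuous_subspaceT (@infd_continuous _ _ C)).
exists (infd C z).
  apply: infd_gt0 => // Cz; have : (B `&` C) z by split => //; exact/set_mem.
  by rewrite BC0.
move=> x y Bx Cy; apply: (le_trans (zmin x _)); first exact/mem_set.
exact: infd_le.
Qed.

(** * Entropy of an iterated join *)

Section Gibbs.
Context {R : realType}.

(** This is ln x <= x - 1 at x = q/p; at p = 0 the convention 0 * ln 0 = 0 leaves 0 <= q. *)
Lemma xlnx_gibbs (p q : R) : 0 <= p -> 0 < q -> p * ln q - p * ln p <= q - p.
Proof.
rewrite le_eqVlt => /predU1P[<- q0|p0 q0]; first by rewrite !mul0r !subr0 ltW.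
have qp0 : 0 < q / p by rewrite divr_gt0.
have : ln (q / p) <= q / p - 1.
  have := @le_ln1Dx _ (q / p - 1); rewrite addrCA subrr addr0; apply.
  by rewrite ltrBrDl subrr.
rewrite ln_div ?posrE// => h.
rewrite -mulrBr (le_trans (ler_wpM2l (ltW p0) h))//.
by rewrite mulrBr mulr1 mulrCA divff ?mulr1// gt_eqF.
Qed.

(** The vector [q] may have total mass below 1, as does the test vector of the entropy estimate when
    some factor loses mass. *)
Lemma gibbs_inequality (I : finType) (p q : I -> R) :
  (forall i, 0 <= p i) -> \sum_i p i = 1 ->
  (forall i, 0 < q i) -> \sum_i q i <= 1 ->
  - \sum_i p i * ln (p i) <= - \sum_i p i * ln (q i).
Proof.
move=> p0 p1 q0 q1; rewrite lerN2 -subr_le0 -sumrB.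
apply: (@le_trans _ _ (\sum_i (q i - p i))).
  by apply: ler_sum => i _; exact: xlnx_gibbs.
by rewrite sumrB p1 subr_le0.
Qed.

End Gibbs.

(** Integrates a pointwise inequality between simple functions. The sets may overlap, as the bad
    sets of the entropy estimate do. *)
Lemma sum_measure_le (R : realType) d (T : measurableType d)
    (mu : probability T R) (I J : finType) (c : I -> R) (e : J -> R)
    (A : I -> set T) (B : J -> set T) :
  (forall i, 0 <= c i) -> (forall j, 0 <= e j) ->
  (forall i, measurable (A i)) -> (forall j, measurable (B j)) ->
  (forall x, \sum_i c i * \1_(A i) x <= \sum_j e j * \1_(B j) x) ->
  \sum_i c i * fine (mu (A i)) <= \sum_j e j * fine (mu (B j)).
Proof.
move=> c0 e0 mA mB AB.
have E (K : finType) (a : K -> R) (D : K -> set T) :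
    (forall i, 0 <= a i) -> (forall i, measurable (D i)) ->
    (\int[mu]_x (\sum_i a i * \1_(D i) x)%:E)%E = (\sum_i a i * fine (mu (D i)))%:E.
  move=> a0 mD; under eq_integral do rewrite -sumEFin.
  rewrite ge0_integral_sum//; last 2 first.
  - move=> i; apply/measurable_EFinP; apply: measurable_funM => //.
  - by move=> i x _; rewrite lee_fin mulr_ge0.
  rewrite -sumEFin; apply: eq_bigr => i _.
  under eq_integral do rewrite EFinM.
  rewrite ge0_integralZl_EFin//; last exact/measurable_EFinP.
  by rewrite integral_indic// setIT EFinM fineK// fin_num_measure.
rewrite -lee_fin -!E//; apply: ge0_le_integral => //.
- by move=> x _; rewrite lee_fin sumr_ge0// => i _; rewrite mulr_ge0.
- apply/measurable_EFinP; apply: measurable_sum => i.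
  by apply: measurable_funM => //.
- apply/measurable_EFinP; apply: measurable_sum => i.
  by apply: measurable_funM => //.
- by move=> x _; rewrite lee_fin.
Qed.

Section IteratedJoin.
Context {R : realType} {X : pmetricType R}.
Variables (f : X -> X) (k : nat) (P : 'I_k -> set (borel X)).
Hypothesis partP : measurable_partition P.

Lemma partition_uniq x i j : P i x -> P j x -> i = j.
Proof.
case: partP => _ /trivIsetP tP _ Pi Pj; apply: contrapT => /eqP ij.
by have := tP i j I I ij; rewrite -subset0 => /(_ x); apply.
Qed.

Lemma iterated_join_cover n x : exists w, iterated_join f P (n := n) w x.
Proof.
have [_ _ cP] := partP.
have /choice[w Pw] : forall i : 'I_n, exists j, P j (iter i f x).
  move=> i; have : [set: borel X] (iter i f x) by [].
  by rewrite -cP => -[j _ Pj]; exists j.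
by exists (finfun w) => i; rewrite ffunE.
Qed.

Lemma iterated_join_uniq n x v w :
  iterated_join f P (n := n) v x -> iterated_join f P w x -> v = w.
Proof. by move=> vx wx; apply/ffunP => i; exact: partition_uniq (vx i) (wx i). Qed.

Hypothesis cf : continuous f.

Lemma iter_continuous n : continuous (iter n f).
Proof.
elim: n => [|n IH] x; first exact: cvg_id.
by apply: (@continuous_comp _ _ _ (iter n f) f); [exact: IH|exact: cf].
Qed.

Lemma measurable_preimage_iter n (A : set (borel X)) : measurable A ->
  measurable (iter n f @^-1` A : set (borel X)).
Proof.
move=> mA; rewrite -[X in measurable X]setTI.
exact: (continuous_borel_map (@iter_continuous n)).
Qed.

Lemma measurable_iterated_join n w : measurable (iterated_join f P (n := n) w).
Proof.
rewrite (_ : iterated_join _ _ _ =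
    \bigcap_(i in [set: 'I_n]) (iter i f @^-1` P (w i))).
  apply: fin_bigcap_measurable => // i _; apply: measurable_preimage_iter.
  by case: partP.
by apply/seteqP; split=> [x wx i _|x wx i]; [exact: wx|exact: wx i I].
Qed.

Lemma sum_iterated_join_indic n (c : {ffun 'I_n -> 'I_k} -> R) w x :
  iterated_join f P w x ->
  \sum_v c v * \1_(iterated_join f P (n := n) v) x = c w.
Proof.
move=> wx; rewrite (bigD1 w)//= indicE mem_set// mulr1 big1 ?addr0// => v vw.
rewrite indicE memNset ?mulr0// => vx.
by move/eqP: vw; apply; exact: iterated_join_uniq vx wx.
Qed.

Lemma sum_iterated_join (mu : probability (borel X) R) n :
  \sum_w fine (mu (iterated_join f P (n := n) w)) = 1.
Proof.
(* Each point lies in exactly one set of the join, so the indicators sum to 1; comparison with the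
   whole space in both directions gives total mass 1. *)
have E x : \sum_w 1 * \1_(iterated_join f P (n := n) w) x =
    \sum_(j : unit) 1 * \1_[set: borel X] x :> R.
  have [w wx] := iterated_join_cover n x.
  rewrite (sum_iterated_join_indic (fun=> 1) wx) big_const card_unit/=.
  by rewrite indicT addr0 mulr1.
have mJ := @measurable_iterated_join n.
have T1 : \sum_(j : unit) 1 * fine (mu [set: borel X]) = 1.
  rewrite big_const card_unit/= addr0 mul1r -[RHS]/(fine 1).
  by rewrite -(probability_setT mu).
have S : \sum_w 1 * fine (mu (iterated_join f P (n := n) w)) =
    \sum_w fine (mu (iterated_join f P (n := n) w)).
  by apply: eq_bigr => w _; rewrite mul1r.
rewrite -S; apply: etrans _ T1; apply/eqP; rewrite eq_le; apply/andP; split.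
  by apply: sum_measure_le => // x; rewrite E.
by apply: sum_measure_le => // x; rewrite E.
Qed.

End IteratedJoin.

Section EntropyOfIteratedJoin.
Context {R : realType} {X : pmetricType R}.
Variables (f : X -> X) (mu : probability (borel X) R).
Hypotheses (cf : continuous f) (mu_inv : invariant_measures f mu).

Lemma invariant_iter n (A : set (borel X)) : measurable A ->
  mu (iter n f @^-1` A) = mu A.
Proof.
elim: n A => [//|n IH] A mA.
rewrite (_ : _ @^-1` _ = iter n f @^-1` (f @^-1` A)) ?IH//; first exact: mu_inv.
exact: (@measurable_preimage_iter _ _ _ cf 1%N).
Qed.

Lemma bowen_dist_ge n i x y : (i < n)%N ->
  mdist (iter i f x) (iter i f y) <= bowen_dist f n x y.
Proof.
move=> ilt.
exact: (le_bigmax (0 : R) (fun i : 'I_n => mdist (iter i f x) (iter i f y)) (Ordinal ilt)).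
Qed.

(* By the Gibbs inequality it suffices to exhibit a probability vector [q] on
   words charging the itinerary of each point enough: [q] averages, over the
   points [y] of a spanning set, the product measures which put half of their
   i-th mass on the block [B j] close to [f^i y] and spread the other half. *)
Lemma partition_entropy_spanning_le k (P : 'I_k -> set (borel X))
    (B : 'I_k -> set (borel X)) n (e : R) (s : seq X) :
  (0 < k)%N -> measurable_partition P ->
  (forall j, measurable (B j)) -> (forall j, B j `<=` P j) ->
  (forall i j x y, B i x -> B j y -> mdist x y <= e + e -> i = j) ->
  (0 < size s)%N ->
  (forall x, exists2 y, y \in s & bowen_dist f n x y <= e) ->
  partition_entropy mu (@iterated_join _ _ f k P n) <=
    ln (size s)%:R + n%:R * (ln 2 + ln k%:R * fine (mu (~` \bigcup_j B j))).
Proof.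
move=> k0 partP mB BP sepB s0 spans.
(* Two blocks within [e] of the same point would be within 2e of each other, so [sepB] leaves at
   most one candidate. *)
pose J y i : option 'I_k :=
  [pick j | `[< exists2 z, B j z & mdist z (iter i f y) <= e >]].
(* The uniform half of the mass keeps every factor positive; when no block is near, the other half
   is dropped and the total is 1/2. *)
pose r y (i : 'I_n) (j : 'I_k) : R := (J y i == Some j)%:R / 2 + (2 * k%:R)^-1.
pose q (w : {ffun 'I_n -> 'I_k}) :=
  (size s)%:R^-1 * \sum_(y <- s) \prod_i r y i (w i).
have kR0 : 0 < k%:R :> R by rewrite ltr0n.
have sR0 : 0 < (size s)%:R :> R by rewrite ltr0n.
have k20 : 0 < (2 * k%:R)^-1 :> R by rewrite invr_gt0 mulr_gt0.
have r0 y i j : 0 < r y i j by rewrite ltr_wpDl// divr_ge0.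
have r1 y i : \sum_j r y i j <= 1.
  rewrite big_split/= sumr_const card_ord -mulr_suml.
  have -> : (2 * k%:R)^-1 *+ k = 2^-1 :> R.
    by rewrite -[LHS]mulr_natr invfM -mulrA mulVf ?mulr1// gt_eqF.
  suff : \sum_j (J y i == Some j)%:R <= 1 :> R by lra.
  case: (J y i) => [j0|]; last by rewrite big1.
  rewrite (bigD1 j0)//= eqxx big1 ?addr0// => j jj0.
  by rewrite (_ : (Some j0 == Some j) = (j0 == j))// eq_sym (negbTE jj0).
have prodr0 y (w : {ffun 'I_n -> 'I_k}) : 0 < \prod_i r y i (w i) by exact: prodr_gt0.
have q_ge y (w : {ffun 'I_n -> 'I_k}) : y \in s ->
    (size s)%:R^-1 * \prod_i r y i (w i) <= q w.
  move=> ys; rewrite ler_wpM2l ?invr_ge0 ?ler0n//.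
  rewrite (big_rem y)//= lerDl; apply: sumr_ge0 => z _; exact: ltW.
have q0 w : 0 < q w.
  have [y ys _] := spans point.
  by apply: lt_le_trans (q_ge y w ys); rewrite mulr_gt0// invr_gt0.
have q1 : \sum_w q w <= 1.
  rewrite -mulr_sumr ler_pdivrMl// mulr1 exchange_big/=.
  apply: (@le_trans _ _ (\sum_(y <- s) 1)); last first.
    by rewrite big_const_seq count_predT iter_addr_0.
  apply: ler_sum => y _; rewrite -(bigA_distr_bigA (fun i j => r y i j)).
  apply: prodr_ile1 => i _; rewrite r1 andbT; apply: sumr_ge0 => j _; exact: ltW.
pose D (i : 'I_n) : set (borel X) := iter i f @^-1` (~` \bigcup_j B j).
have mBad : measurable (~` \bigcup_j B j).
  by apply: measurableC; apply: fin_bigcup_measurable.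
have mD i : measurable (D i) by exact: measurable_preimage_iter.
have lnk0 : 0 <= ln k%:R :> R by rewrite ln_ge0// ler1n.
(* At a time when the orbit of [x] lies in some [B j] the factor is at least 1/2 and costs ln 2; at
   a bad time it is at least 1/(2k) and costs a further ln k. *)
have key w x : iterated_join f P w x ->
    - ln (q w) <= ln (size s)%:R + n%:R * ln 2 + \sum_i ln k%:R * \1_(D i) x.
  move=> wx; have [y ys xy] := spans x.
  rewrite lerNl -[leLHS]expRK ler_ln ?posrE ?expR_gt0//.
  apply: le_trans (q_ge y w ys).
  rewrite !opprD -addrA expRD expRN lnK ?posrE// ler_wpM2l ?invr_ge0 ?ler0n//.
  have -> : - (n%:R * ln 2) - \sum_i ln k%:R * \1_(D i) x =
      \sum_(i < n) - (ln 2 + ln k%:R * \1_(D i) x) :> R.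
    by rewrite sumrN big_split/= sumr_const card_ord mulr_natl opprD.
  rewrite expR_sum; apply: ler_prod => i _; rewrite expR_ge0/=.
  have [Dx|nDx] := pselect (D i x).
    rewrite indicE mem_set// mulr1 opprD expRD !expRN !lnK ?posrE//.
    by rewrite -invfM lerDr divr_ge0.
  rewrite indicE memNset// mulr0 addr0 expRN lnK ?posrE//.
  have [j _ Bj] : (\bigcup_j B j) (iter i f x) by apply: contrapT.
  have jw : j = w i.
      by apply: (partition_uniq partP (x := iter i f x)); [exact: BP|exact: wx].
  have xyi : mdist (iter i f x) (iter i f y) <= e.
    by apply: le_trans xy; exact: bowen_dist_ge.
  have -> : r y i (w i) = 2^-1 + (2 * k%:R)^-1.
    rewrite /r (_ : J y i == Some (w i)) ?mul1r// /J; case: pickP => [j'|].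
      move=> /asboolP[z Bz zy]; rewrite -jw; apply/eqP; congr Some.
      apply: sepB Bz Bj _; apply: le_trans (metric_triangle _ (iter i f y) _) _.
      by rewrite lerD// metric_sym.
    by move=> /(_ j) /asboolP; case; exists (iter i f x).
  by rewrite lerDl ltW.
apply: le_trans (gibbs_inequality _ _ q0 q1) _.
- by move=> w; rewrite fine_ge0.
- exact: sum_iterated_join.
have q1w w : q w <= 1.
  apply: le_trans q1; rewrite (bigD1 w)//= lerDl.
  by apply: sumr_ge0 => v _; exact: ltW.
rewrite -sumrN.
(* The index [inl tt] carries the constant cost on the whole space and [inr i] the cost of a bad
   visit at time [i]; by invariance all bad visits have the same probability. *)
pose E (z : unit + 'I_n) : R :=
  if z is inr _ then ln k%:R else ln (size s)%:R + n%:R * ln 2.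
pose Z (z : unit + 'I_n) := if z is inr i then D i else setT.
have sumE (h : unit + 'I_n -> R) : \sum_z h z = h (inl tt) + \sum_i h (inr i).
  by rewrite big_sumType/=; congr (_ + _); rewrite (big_pred1 tt)// => -[].
have := @sum_measure_le _ _ _ mu _ _ (fun w => - ln (q w)) E
  (fun w => iterated_join f P w) Z.
rewrite sumE /=.
have -> : fine (mu [set: borel X]) = 1.
  by rewrite -[RHS]/(fine 1) -(probability_setT mu).
under [X in _ + X]eq_bigr do rewrite /D invariant_iter//.
rewrite sumr_const card_ord mulr1 => H.
under eq_bigr do rewrite -mulrN mulrC.
rewrite mulrDr addrA [n%:R * (ln k%:R * _)]mulr_natl; apply: H.
- by move=> w; rewrite oppr_ge0 ln_le0.
- case=> [u|i]; rewrite /E// addr_ge0 ?ln_ge0 ?ler1n// mulr_ge0 ?ln_ge0 ?ler1n//.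
- move=> w; exact: measurable_iterated_join.
- by case=> [u|i]; [exact: measurableT|exact: mD].
- move=> x; have [w wx] := iterated_join_cover f partP n x.
  rewrite (sum_iterated_join_indic partP (fun w => - ln (q w)) wx) sumE/=.
  by rewrite indicT mulr1; exact: key.
Qed.

End EntropyOfIteratedJoin.

(** * Finite topological entropy bounds measure-theoretic entropy *)

Section TopologicalEntropy.
Context {R : realType} {X : pmetricType R}.
Variable f : X -> X.
Implicit Types (n : nat) (e : R) (s : seq X).

Lemma separated_card_le_anti n e1 e2 : e1 <= e2 ->
  (separated_card f n e2 <= separated_card f n e1)%E.
Proof.
move=> e12; apply: ereal_sup_le => _ [s [us ss] <-]; exists s => //.
by split => // x y xs ys xy; apply: le_lt_trans e12 _; exact: ss.
Qed.

Lemma separated_card_ge1 n e : (1 <= separated_card f n e)%E.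
Proof.
apply: ereal_sup_ubound; exists [:: point] => //; split => // x y.
by rewrite !inE => /eqP -> /eqP ->; rewrite eqxx.
Qed.

Lemma limn_esup_le (u v : nat -> \bar R) : (forall n, (u n <= v n)%E) ->
  (limn_esup u <= limn_esup v)%E.
Proof.
move=> uv; apply: le_ereal_inf_tmp => _ [V FV <-].
apply: (@le_trans _ _ (ereal_sup [set u x | x in V])).
  by apply: ereal_inf_lbound; exists V.
apply: ge_ereal_sup => _ [n Vn <-]; apply: le_trans (uv n) _.
by apply: ereal_sup_ubound; exists n.
Qed.

Lemma limn_esup_lt_near (u : nat -> \bar R) (c : \bar R) : (limn_esup u < c)%E ->
  \forall n \near \oo, (u n < c)%E.
Proof.
move=> /ereal_inf_lt[_ [V FV <-] Vc]; apply: filterS FV => n Vn.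
by apply: le_lt_trans Vc; apply: ereal_sup_ubound; exists n.
Qed.

Let growth e := limn_esup (fun n => ((n%:R)^-1)%:E * lne (separated_card f n e))%E.

(** The growth rate is nonincreasing in the scale, so its limit at 0 from the right is the supremum
    over all scales. *)
Lemma growth_le_topological_entropy e : 0 < e -> (growth e <= topological_entropy f)%E.
Proof.
move=> e0.
have ni : {in Interval (BRight (0 : R)) +oo%O &,
    forall x y, x <= y -> (growth y <= growth x)%E}.
  move=> x y _ _ xy; apply: limn_esup_le => n; apply: lee_wpmul2l.
    by rewrite lee_fin invr_ge0 ler0n.
  have sc0 z : separated_card f n z \in `[0%E, +oo%E].
    by rewrite in_itv/= leey andbT (le_trans _ (separated_card_ge1 n z)).
  by rewrite lee_lne//; exact: separated_card_le_anti.
have := nonincreasing_at_right_cvge _ (isT : (BRight (0 : R) < +oo)%O) ni.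
move=> /cvg_lim; rewrite /topological_entropy -/growth => ->//.
by apply: ereal_sup_ubound; exists e => //=; rewrite in_itv/= andbT.
Qed.

(** Any real [C] above the topological entropy serves every scale; only the time from which the
    bound holds depends on [e]. This makes the later entropy bound independent of the partition. *)
Lemma topological_entropy_separated : (topological_entropy f < +oo)%E ->
  exists C : R, forall e, 0 < e -> \forall n \near \oo,
    (separated_card f n e <= (expR (n%:R * C))%:E)%E.
Proof.
move=> htop.
have [C hC] : exists C : R, (topological_entropy f < C%:E)%E.
  move: htop; case: (topological_entropy f) => [r| |] // _.
  - by exists (r + 1); rewrite lte_fin ltrDl.
  - by exists 0; rewrite ltNyr.
exists C => e e0.
have := limn_esup_lt_near (le_lt_trans (growth_le_topological_entropy e0) hC).
have : \forall n \near \oo, (0 < n)%N by exists 1%N.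
apply: filterS2 => n n0; have := separated_card_ge1 n e.
have nR : 0 < n%:R :> R by rewrite ltr0n.
case: (separated_card f n e) => [r| |]//.
- rewrite lee_fin => r1.
  have r0 : 0 < r by exact: lt_le_trans r1.
  rewrite lne_EFin// -EFinM lte_fin ltr_pdivrMl// => h.
  by rewrite lee_fin -[leLHS]lnK ?posrE// ler_expR ltW.
- by move=> _; rewrite gt0_muley// lte_fin invr_gt0.
Qed.

(** A separated set of largest cardinality is spanning, since a point far from all its members could
    be added; the bound [M] makes a largest one exist. *)
Lemma maximal_separated n e (M : R) : 0 <= e -> (separated_card f n e <= M%:E)%E ->
  exists s, [/\ (0 < size s)%N, (size s)%:R <= M &
    forall x, exists2 y, y \in s & bowen_dist f n x y <= e].
Proof.
move=> e0 scM.
have sM s : Defs.separated f n e s -> (size s)%:R <= M.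
  move=> sep; rewrite -lee_fin; apply: le_trans scM.
  by apply: ereal_sup_ubound; exists s.
pose P k := `[< exists2 s, Defs.separated f n e s & size s = k >].
have P0 : exists k, P k by exists 0%N; apply/asboolP; exists [::].
have PM k : P k -> (k <= Num.truncn M)%N.
  by move=> /asboolP[s /sM sM' <-]; rewrite truncn_ge_nat// (le_trans _ sM').
case: (ex_maxnP P0 PM) => k /asboolP[s [us ss] sk] kmax.
have cover x : exists2 y, y \in s & bowen_dist f n x y <= e.
  have bxx : bowen_dist f n x x <= e.
    by rewrite /bowen_dist; apply: bigmax_le => // i _; rewrite mdistxx.
  have bsym y z : bowen_dist f n y z = bowen_dist f n z y.
    by rewrite /bowen_dist; apply: eq_bigr => i _; rewrite metric_sym.
  have [xs|xs] := boolP (x \in s); first by exists x.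
  apply: contrapT => nx.
  have far y : y \in s -> e < bowen_dist f n x y.
    by move=> ys; rewrite ltNge; apply/negP => xy; apply: nx; exists y.
  suff : P k.+1 by move/kmax; rewrite ltnn.
  apply/asboolP; exists (x :: s); last by rewrite /= sk.
  split; first by rewrite /= xs.
  move=> y z; rewrite !inE => /predU1P[->|ys] /predU1P[->|zs].
  - by rewrite eqxx.
  - by move=> _; exact: far.
  - by move=> _; rewrite bsym; exact: far.
  - exact: ss.
exists s; split => //; last by apply: sM.
by case: (cover point) => y; case: (s).
Qed.

End TopologicalEntropy.

Lemma uniform_separation (R : realType) (X : pmetricType R) k (B : 'I_k -> set X) :
  compact [set: X] -> (forall j, closed (B j)) -> trivIset setT B ->
  exists2 d : R, 0 < d & forall i j x y, B i x -> B j y -> mdist x y < d -> i = j.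
Proof.
move=> cptX cB tB.
have /choice[d dP] : forall p : 'I_k * 'I_k, exists d : R, 0 < d /\
    (p.1 != p.2 -> forall x y, B p.1 x -> B p.2 y -> d <= mdist x y).
  move=> [i j]; have [<-|ij] := eqVneq i j; first by exists 1; split=> //=; rewrite eqxx.
  have [d d0 dB] := closed_separation cptX (cB i) (cB j)
    ((iffLR trivIsetP tB) i j I I ij).
  by exists d.
exists (\big[Num.min/1]_p d p).
  by apply/bigmin_gtP; split => // p _; have [] := dP p.
move=> i j x y Bx By xy; apply/eqP; apply: contraT => ij.
have [_ /(_ ij x y Bx By)] := dP (i, j).
rewrite leNgt => /negP; case; apply: lt_le_trans xy _.
exact: (bigmin_inf (i, j)).
Qed.

Section EntropyBound.
Context {R : realType} {X : pmetricType R}.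
Variable f : X -> X.
Hypotheses (cptX : compact [set: X]) (cf : continuous f).
Hypothesis fin_htop : (topological_entropy f < +oo)%E.

(** The complement of the closed sets is covered by the k differences between a block and its closed
    subset, each of measure at most [e]. *)
Lemma closed_subpartition (mu : probability (borel X) R) k
    (P : 'I_k -> set (borel X)) (e : R) :
  measurable_partition P -> 0 < e ->
  exists B : 'I_k -> set (borel X), [/\ forall j, closed (B j : set X),
    forall j, B j `<=` P j & fine (mu (~` \bigcup_j B j)) <= k%:R * e].
Proof.
move=> [mP tP cP] e0.
have mu_fin : (mu [set: borel X] < +oo)%E.
  by rewrite (le_lt_trans (probability_le1 mu _)) ?ltry.
have /choice[B BP] : forall j, exists C : set (borel X),
    [/\ closed (C : set X), C `<=` P j & (mu (P j `\` C) <= e%:E)%E].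
  by move=> j; exact: closed_inner_regular.
exists B; split; [by move=> j; case: (BP j)..|].
have mB j : measurable (B j) by apply: closed_borel; case: (BP j).
have := @sum_measure_le _ _ _ mu _ _ (fun _ : unit => 1) (fun _ : 'I_k => 1)
  (fun _ => ~` \bigcup_j B j) (fun j => P j `\` B j).
rewrite (big_pred1 tt) => [|[]//]; rewrite mul1r => H.
apply: (@le_trans _ _ (\sum_(j < k) 1 * fine (mu (P j `\` B j)))).
  apply: H => //.
  - by move=> _; apply: measurableC; exact: fin_bigcup_measurable.
  - by move=> j; exact: measurableD.
  - move=> x; rewrite (big_pred1 tt) => [|[]//]; rewrite mul1r.
    have [nBx|Bx] := pselect ((~` \bigcup_j B j) x); last first.
      by rewrite indicE memNset//; apply: sumr_ge0 => j _; rewrite mul1r.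
    have : [set: borel X] x by []. rewrite -cP => -[j _ Pj].
    rewrite (bigD1 j)//= mul1r !indicE !mem_set// ?lerDl.
      by apply: sumr_ge0 => i _; rewrite mul1r.
    by split => // Bj; apply: nBx; exists j.
apply: (@le_trans _ _ (\sum_(j < k) e)); last first.
  by rewrite sumr_const card_ord mulr_natl.
apply: ler_sum => j _; rewrite mul1r -lee_fin fineK; first by case: (BP j).
by rewrite fin_num_measure//; exact: measurableD.
Qed.

Lemma ks_entropy_bounded : exists C : R, forall mu : probability (borel X) R,
  invariant_measures f mu -> (ks_entropy f mu <= C%:E)%E.
Proof.
have [C0 sepC0] := topological_entropy_separated fin_htop.
(* The term ln 2 comes from halving the test masses and 1 from the bad visits; the maximum with 0
   covers a sequence without limit. *)
pose C := Num.max 0 (C0 + ln 2 + 1); exists C => mu mu_inv.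
apply: ge_ereal_sup => _ [k [P [partP ->]]].
have [_ tP cP] := partP.
have k0 : (0 < k)%N.
  have : [set: borel X] point by []. rewrite -cP => -[[j jk] _ _].
  exact: leq_ltn_trans jk.
have kR : 0 < k%:R :> R by rewrite ltr0n.
have lnk : 0 <= ln k%:R :> R by rewrite ln_ge0// ler1n.
(* With this value k * eps * ln k = ln k / (1 + ln k) <= 1. *)
pose eps : R := (k%:R * (1 + ln k%:R))^-1.
have eps0 : 0 < eps by rewrite invr_gt0 mulr_gt0// ltr_wpDr.
have [B [cB BP muB]] := closed_subpartition mu partP eps0.
have bad1 : ln k%:R * fine (mu (~` \bigcup_j B j)) <= 1.
  apply: le_trans (ler_wpM2l lnk muB) _.
  rewrite /eps invfM [k%:R * _]mulrA divff ?gt_eqF// mul1r.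
  by rewrite ler_pdivrMr ?mul1r ?lerDr// ltr_wpDr.
have tB : trivIset setT (B : 'I_k -> set X).
  apply/trivIsetP => i j _ _ ij; rewrite -subset0 => x [Bi Bj].
  by move/eqP: ij; apply; apply: (partition_uniq partP (x := x)); exact: BP.
have [d d0 dB] := uniform_separation cptX cB tB.
(* At scale d/3, blocks at distance at most twice the scale are closer than [d] and hence equal. *)
have d30 : 0 < d / 3 by rewrite divr_gt0.
have bound : \forall n \near \oo,
    ((partition_entropy mu (@iterated_join _ _ f k P n) / n%:R)%:E <= C%:E)%E.
  have := sepC0 _ d30; have : \forall n \near \oo, (0 < n)%N by exists 1%N.
  apply: filterS2 => n n0 sc.
  have nR : 0 < n%:R :> R by rewrite ltr0n.
  have [s [s0 sM span]] := maximal_separated (ltW d30) sc.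
  have sR : 0 < (size s)%:R :> R by rewrite ltr0n.
  rewrite lee_fin le_max; apply/orP; right; rewrite ler_pdivrMr// [leRHS]mulrC.
  apply: le_trans (partition_entropy_spanning_le cf mu_inv k0 partP _ BP _ s0 span) _.
  - by move=> j; exact: closed_borel.
  - move=> i j x y Bx By xy; apply: (dB i j x y) => //; apply: le_lt_trans xy _; lra.
  - rewrite -addrA [leRHS]mulrDr lerD//.
      by rewrite -[leRHS]expRK ler_ln ?posrE ?expR_gt0.
    by rewrite ler_wpM2l// lerD2l.
(* The [limn] of a divergent sequence is the default [point], which is 0 here and hence at most
   [C]. *)
rewrite /entropy_of_partition.
have [cv|/dvgP ->] := pselect (cvgn (fun n =>
    (partition_entropy mu (@iterated_join _ _ f k P n) / n%:R)%:E)).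
  exact: lime_le.
by rewrite -[point]/(0%:E) lee_fin le_max lexx.
Qed.

Lemma ks_entropy_ge0 (mu : probability (borel X) R) : (0 <= ks_entropy f mu)%E.
Proof.
apply: ereal_sup_ubound; exists 1%N, (fun=> setT); split.
  split=> [//|i j _ _ _|]; first by rewrite !ord1.
  by apply/seteqP; split => // x _; exists ord0.
rewrite /entropy_of_partition; apply/esym.
rewrite (_ : (fun n => _) = cst 0%E) ?lim_cst//.
apply/funext => n /=; rewrite /partition_entropy big1 ?oppr0 ?mul0r// => w _.
rewrite (_ : iterated_join _ _ _ = setT); last by apply/seteqP; split => // x _ i.
have -> : fine (mu [set: borel X]) = 1.
  by rewrite -[RHS]/(fine 1) -(probability_setT mu).
by rewrite ln1 mulr0.
Qed.

End EntropyBound.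

(** * Nets, subsequences and cells *)

Lemma finite_net (R : realType) (X : pmetricType R) (e : R) :
  compact [set: X] -> 0 < e ->
  exists s : seq X, forall x, exists2 y, y \in s & (ball y e)° x.
Proof.
rewrite compact_cover => cptX e0.
have [|x _|D _ cD] := cptX X setT (fun x => (ball x e)°).
- by move=> x _; exact: open_interior.
- by exists x => //; exact: nbhsx_ballx.
- by exists (finmap.enum_fset D) => x; have [y yD yx] := cD x I; exists y.
Qed.

(** The family lists the balls of finite nets at all scales 1/(n+1), coding pairs by [pickle]. Since
    each net is finite, a single [N] bounds the codes used at one scale. *)
Lemma refining_balls (R : realType) (X : pmetricType R) : compact [set: X] ->
  exists B : nat -> set X, (forall j, open (B j)) /\
    forall e : R, 0 < e -> exists N, forall x, exists j,
      [/\ (j < N)%N, B j x & forall y z, B j y -> B j z -> mdist y z < e].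
Proof.
move=> cptX.
have /choice[s sP] : forall n : nat, exists s : seq X,
    forall x, exists2 y, y \in s & (ball y (n.+1%:R^-1 : R))° x.
  by move=> n; apply: finite_net => //; rewrite invr_gt0.
pose B (j : nat) : set X := if unpickle j is Some (n, i)
  then (ball (nth point (s n) i) (n.+1%:R^-1 : R))° else set0.
exists B; split.
  move=> j; rewrite /B; case: (unpickle j) => [[n i]|]; last exact: open0.
  exact: open_interior.
move=> e e0; have e20 : 0 < e / 2 by rewrite divr_gt0.
near \oo => n.
have ne : n.+1%:R^-1 < e / 2 by near: n; exact: near_infty_natSinv_lt (PosNum e20).
exists (\max_(i < size (s n)) pickle (n, nat_of_ord i)).+1 => x.
have [y ys yx] := sP n x.
have ilt : (index y (s n) < size (s n))%N by rewrite index_mem.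
exists (pickle (n, index y (s n))); rewrite /B pickleK nth_index//; split => //.
  rewrite ltnS.
  exact: (leq_bigmax (F := fun i : 'I__ => pickle (n, nat_of_ord i)) (Ordinal ilt)).
move=> u v /interior_subset yu /interior_subset yv.
move: yu yv; rewrite !ballEmdist/= => yu yv.
apply: le_lt_trans (metric_triangle _ y _) _; rewrite metric_sym.
by rewrite [e]splitr ltrD// (lt_trans _ ne).
Unshelve. all: by end_near. Qed.

Section Subsequence.

Lemma choose_subsequence (Q : nat -> nat -> Prop) :
  (forall k m, exists2 n, (m <= n)%N & Q k n) ->
  exists sigma : nat -> nat, (forall n, (sigma n < sigma n.+1)%N) /\
    forall k, Q k (sigma k).
Proof.
move=> hQ.
have /choice[h hP] : forall km : nat * nat, exists n, (km.2 <= n)%N /\ Q km.1 n.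
  by move=> [k m]; have [n mn Qn] := hQ k m; exists n.
pose sigma := fix sigma n := if n is n'.+1 then h (n, (sigma n').+1) else h (0%N, 0%N).
exists sigma; split=> [n|[|k]]; first by have [] := hP (n.+1, (sigma n).+1).
  by have [] := hP (0%N, 0%N).
by have [] := hP (k.+1, (sigma k).+1).
Qed.

Lemma increasing_ge_id (sigma : nat -> nat) :
  (forall n, (sigma n < sigma n.+1)%N) -> forall n, (n <= sigma n)%N.
Proof. by move=> s; elim=> // n IH; exact: leq_ltn_trans IH (s n). Qed.

(** Tychonoff gives a cluster point in the cube. Meeting in turn the neighbourhoods that control the
    coordinates of code below k to within 1/(k+1) extracts a subsequence. *)
Lemma bounded_family_subsequence (R : realType) (I : countType) (a : nat -> I -> R) :
  (forall n i, 0 <= a n i <= 1) ->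
  exists (sigma : nat -> nat) (p : I -> R), (forall n, (sigma n < sigma n.+1)%N) /\
    forall i, a (sigma n) i @[n --> \oo] --> p i.
Proof.
move=> a01.
have cK := @tychonoff I (fun=> R) (fun=> `[0, 1]%classic) (fun=> @segment_compact R 0 1).
have [|p [_ clp]] := cK (a @ \oo) _.
  by exists 0%N => // n _ i; rewrite /= in_itv/=.
pose F := nbhs (p : prod_topology (fun _ : I => R)).
have FF : Filter F := nbhs_filter (p : prod_topology (fun _ : I => R)).
have close k : F [set q | forall i, (pickle i < k)%N -> `|p i - q i| < k.+1%:R^-1].
  have e0 : 0 < k.+1%:R^-1 :> R by rewrite invr_gt0.
  have H (j : nat) : F [set q | forall i, (pickle i < j)%N -> `|p i - q i| < k.+1%:R^-1].
    elim: j => [|j IH]; first by apply: filterE => q i; rewrite ltn0.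
    have : F [set q | forall i, pickle i = j -> `|p i - q i| < k.+1%:R^-1].
      case E : (@pickle_inv I j) => [i|]; last first.
        by apply: filterE => q i ij; move: E; rewrite -ij pickleK_inv.
      have := @proj_continuous I (fun=> R) i p.
      move=> /cvgrPdist_lt /(_ _ e0); apply: filterS => q pq i' i'j.
      by move: E; rewrite -i'j pickleK_inv => -[->].
    move: IH; apply: filterS2 => q h1 h2 i; rewrite ltnS leq_eqVlt => /predU1P[|].
      exact: h2.
    exact: h1.
  exact: H.
pose Q k n := forall i, (pickle i < k)%N -> `|p i - a n i| < k.+1%:R^-1.
have [k m|sigma [sinc sQ]] := @choose_subsequence Q _.
  have [q [[n /= mn <-] qQ]] := clp [set a n | n in [set n | (m <= n)%N]] _
    (ex_intro2 _ _ m Logic.I (fun n mn => ex_intro2 _ _ n mn erefl)) (close k).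
  by exists n.
exists sigma, p; split => // i; apply/cvgrPdist_lt => e e0.
near=> n; apply: lt_trans (sQ n i _) _; first by near: n; exists (pickle i).+1.
by near: n; exact: near_infty_natSinv_lt (PosNum e0).
Unshelve. all: by end_near. Qed.

End Subsequence.

Lemma Rintegral_sum (R : realType) d (T : measurableType d)
    (mu : {measure set T -> \bar R}) (D : set T) (I : Type) (r : seq I) (F : I -> T -> R) :
  measurable D -> (forall i, mu.-integrable D (EFin \o F i)) ->
  mu.-integrable D (EFin \o (fun t => \sum_(i <- r) F i t)) /\
  \int[mu]_(t in D) (\sum_(i <- r) F i t) = \sum_(i <- r) \int[mu]_(t in D) F i t.
Proof.
move=> mD iF; elim: r => [|i r [IHi IH]].
  split; last by under eq_Rintegral do rewrite big_nil; rewrite big_nil Rintegral_cst// mul0r.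
  have := integrable0 mu D; congr (_.-integrable _ _).
  by apply/funext => t /=; rewrite big_nil.
split.
  have := integrableD mD (iF i) IHi; congr (_.-integrable _ _).
  by apply/funext => t /=; rewrite big_cons EFinD.
under eq_Rintegral do rewrite big_cons.
by rewrite RintegralD// IH big_cons.
Qed.

(** The function [h] is uniformly within [e] of the simple function with values [v], and [Q] has
    mass 1. *)
Lemma integral_cells (R : realType) d (T : measurableType d) (Q : probability T R)
    (W : finType) (A : W -> set T) (h : T -> R) (v : W -> R) (e M : R) :
  measurable_fun setT h -> (forall t, `|h t| <= M) ->
  (forall w, measurable (A w)) -> (forall t, exists w, A w t) ->
  (forall v w t, A v t -> A w t -> v = w) ->
  (forall w t, A w t -> `|h t - v w| <= e) ->
  `|\int[Q]_t h t - \sum_w v w * fine (Q (A w))| <= e.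
Proof.
move=> mh hM mA cA uA hv.
have bint (g : T -> R) (N : R) : measurable_fun setT g -> (forall t, `|g t| <= N) ->
    Q.-integrable setT (EFin \o g).
  move=> mg gN; apply: measurable_bounded_integrable => //.
    by rewrite (le_lt_trans (probability_le1 Q _)) ?ltry.
  exists N; split; first exact: num_real.
  by move=> K /ltW NK x _; exact: le_trans (gN x) NK.
have iind w : Q.-integrable setT (EFin \o (fun t => v w * \1_(A w) t)).
  apply: (bint _ `|v w|); first exact: measurable_funM.
  by move=> t; rewrite normrM ler_piMr// indicE; case: (_ \in _); rewrite ?normr1 ?normr0.
have intind w : \int[Q]_t (v w * \1_(A w) t) = v w * fine (Q (A w)).
  rewrite RintegralZl//; last first.
    apply: (bint _ 1) => [|t]; first exact: measurable_indic.
    by rewrite indicE; case: (_ \in _); rewrite ?normr1 ?normr0.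
  by rewrite /Rintegral integral_indic// setIT.
under eq_bigr do rewrite -intind.
have [is_ <-] := Rintegral_sum (index_enum W) measurableT iind.
rewrite -RintegralB//; last exact: bint hM.
have sumE t w : A w t -> \sum_u v u * \1_(A u) t = v w.
  move=> wt; rewrite (bigD1 w)//= indicE mem_set// mulr1 big1 ?addr0// => u uw.
  rewrite indicE memNset ?mulr0// => ut.
  by move/eqP: uw; apply; exact: uA ut wt.
have he t : `|h t - \sum_w v w * \1_(A w) t| <= e.
  by have [w wt] := cA t; rewrite (sumE _ _ wt); exact: hv.
have mS : measurable_fun setT (fun t => h t - \sum_w v w * \1_(A w) t).
  apply: measurable_funB => //; apply: measurable_sum => w; exact: measurable_funM.
apply: le_trans (le_normr_Rintegral _ _) _ => //; first exact: bint he.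
have -> : e = \int[Q]_(x in setT) e.
  by rewrite Rintegral_cst// -[LHS]mulr1 -[X in _ * X = _]/(fine 1) -(probability_setT Q).
apply: le_Rintegral => //.
- apply: (bint _ e) => [|t]; [exact: measurableT_comp|by rewrite normr_id].
- by apply: (bint _ `|e|).
Qed.

(** * Interval coding and itineraries *)

Section UnitLebesgue.
Context {R : realType}.

Definition unit_lebesgue : set (measurableTypeR R) -> \bar R :=
  mrestr (@lebesgue_measure R) (measurable_itv `[0, 1[).

HB.instance Definition _ := Measure.on unit_lebesgue.

Lemma unit_lebesgueT : unit_lebesgue setT = 1%E.
Proof.
by rewrite /unit_lebesgue /mrestr setTI lebesgue_measure_itv/= lte_fin ltr01 sube0.
Qed.

HB.instance Definition _ :=
  @Measure_isProbability.Build _ _ R unit_lebesgue unit_lebesgueT.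

(* Only [0, 1[ is charged by [unit_lebesgue]; sending the rest of the line to 0
   makes the codes below well behaved at every real number. *)
Definition clamp (s : R) : R := if 0 <= s < 1 then s else 0.

Lemma clamp_itv s : 0 <= clamp s < 1.
Proof. by rewrite /clamp; case: ifP => // _; rewrite lexx ltr01. Qed.

Lemma measurable_clamp : measurable_fun setT clamp.
Proof.
apply: measurable_fun_ifT => //; apply: measurable_and.
  exact: measurable_fun_ler.
exact: measurable_fun_ltr.
Qed.

End UnitLebesgue.

Section IntervalCoding.
Context {R : realType}.
Variable p : seq bool -> R.
Hypotheses (p_nil : p [::] = 1) (p_ge0 : forall w, 0 <= p w).
Hypothesis p_cons : forall w, p w = p (true :: w) + p (false :: w).

(* Words list the most recent binary digit first. *)
Fixpoint left_end (w : seq bool) : R :=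
  if w is b :: w' then left_end w' + (if b then p (false :: w') else 0) else 0.

Fixpoint code (s : R) (k : nat) : seq bool :=
  if k is k'.+1 then (left_end (code s k') + p (false :: code s k') <= s) :: code s k'
  else [::].

Lemma size_code s k : size (code s k) = k.
Proof. by elim: k => //= k ->. Qed.

(** The word [w] codes a half-open interval of length [p w], which its two extensions cut into
    adjacent pieces, the [false] piece on the left. *)
Lemma codeE s w : 0 <= s < 1 ->
  (code s (size w) == w) = (left_end w <= s < left_end w + p w).
Proof.
move=> s01; elim: w => [|b w IH]; first by rewrite /= p_nil add0r s01 eqxx.
rewrite /= eqseq_cons andbC IH; have := p_cons w.
have := p_ge0 (true :: w); have := p_ge0 (false :: w).
have [/andP[h1 h2] pf pt pE|/negP h pf pt pE] := boolP (left_end w <= s < left_end w + p w).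
  have wE : code s (size w) = w by apply/eqP; rewrite IH h1 h2.
  case: b => /=; rewrite wE ?addr0.
    by rewrite eqb_id; apply/idP/andP => [h3|[]//]; split=> //; lra.
  by rewrite eqbF_neg -ltNge; apply/idP/andP => [h3|[]//]; split.
apply/esym/negP => /andP[h1 h2]; apply: h.
by case: b h1 h2; rewrite ?addr0 => h1 h2; apply/andP; split; lra.
Qed.

Lemma left_end_ge0 w : 0 <= left_end w.
Proof. by elim: w => //= b w IH; case: b; rewrite addr_ge0. Qed.

Lemma right_end_le1 w : left_end w + p w <= 1.
Proof.
elim: w => [|b w IH]; first by rewrite /= p_nil add0r.
have := p_cons w; have := p_ge0 (true :: w); have := p_ge0 (false :: w).
by case: b => /=; lra.
Qed.

Lemma measurable_code k w : measurable [set s : measurableTypeR R | code s k = w].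
Proof.
elim: k w => [|k IH] [|b w].
- by rewrite (_ : [set _ | _] = setT)//; apply/seteqP; split.
- by rewrite (_ : [set _ | _] = set0)//; apply/seteqP; split.
- by rewrite (_ : [set _ | _] = set0)//; apply/seteqP; split.
have mle : measurable [set s : measurableTypeR R | left_end w + p (false :: w) <= s].
  by rewrite (_ : [set _ | _] = `[left_end w + p (false :: w), +oo[%classic)//;
    apply/seteqP; split=> s /=; rewrite in_itv/= andbT.
rewrite (_ : [set _ | _] = [set s | code s k = w] `&`
    (if b then [set s | left_end w + p (false :: w) <= s]
     else ~` [set s | left_end w + p (false :: w) <= s])).
  by apply: measurableI => //; case: b => //; exact: measurableC.
apply/seteqP; split=> s /=.
  by case=> bE wE; rewrite wE in bE; split => //; case: b bE => //= /negbT/negP.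
by case=> wE bE; rewrite wE; congr (_ :: _); case: b bE => // /negP/negbTE.
Qed.

Lemma measurable_code_clamp k w :
  measurable [set s : measurableTypeR R | code (clamp s) k = w].
Proof.
rewrite -[X in measurable X]setTI.
exact: (measurable_clamp measurableT (measurable_code k w)).
Qed.

Lemma unit_lebesgue_code w :
  unit_lebesgue [set s | code (clamp s) (size w) = w] = (p w)%:E.
Proof.
rewrite /unit_lebesgue /mrestr.
rewrite (_ : _ `&` _ = `[left_end w, left_end w + p w[%classic).
  rewrite lebesgue_measure_itv/= lte_fin ltrDl; have := p_ge0 w.
  by case: ltgtP => // [_ _|<- _]; rewrite // -EFinB addrAC subrr add0r.
have E s : 0 <= s < 1 -> clamp s = s by rewrite /clamp => ->.
apply/seteqP; split=> s /=; rewrite !in_itv/=.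
  by move=> [] + s01; rewrite E// => /eqP; rewrite codeE.
move=> sw; have s01 : 0 <= s < 1.
  by have := left_end_ge0 w; have := right_end_le1 w; lra.
by split=> //; rewrite E//; apply/eqP; rewrite codeE.
Qed.

(** The half-open interval containing the point is nonempty. Codes that occur thus have positive
    mass, which later provides points in the corresponding cells. *)
Lemma p_code_clamp_gt0 s k : 0 < p (code (clamp s) k).
Proof.
have := codeE (code (clamp s) k) (clamp_itv s); rewrite size_code eqxx => /esym.
by lra.
Qed.

End IntervalCoding.

Section Cells.
Context {R : realType} {X : pmetricType R}.
Variable B : nat -> set X.

Fixpoint itinerary (x : X) (k : nat) : seq bool :=
  if k is k'.+1 then `[< B k' x >] :: itinerary x k' else [::].

Lemma size_itinerary x k : size (itinerary x k) = k.
Proof. by elim: k => //= k ->. Qed.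

Definition cell (w : seq bool) : set (borel X) := [set x | itinerary x (size w) = w].

Lemma cell_itinerary x k : cell (itinerary x k) x.
Proof. by rewrite /cell/= size_itinerary. Qed.

Lemma cell_uniq v w x : size v = size w -> cell v x -> cell w x -> v = w.
Proof. by rewrite /cell/= => -> -> ->. Qed.

Lemma cell_consE b w : cell (b :: w) = cell w `&` [set x | `[< B (size w) x >] = b].
Proof. by apply/seteqP; split=> x; rewrite /cell/= => -[-> ->]. Qed.

Lemma cell_split w : cell w = cell (true :: w) `|` cell (false :: w).
Proof.
rewrite !cell_consE -setIUr; apply/seteqP; split=> x; last by case.
by move=> wx; split => //=; case: asboolP; [left|right].
Qed.

Hypothesis oB : forall j, open (B j).

Lemma measurable_cell w : measurable (cell w).
Proof.
elim: w => [|b w IH]; first by rewrite (_ : cell [::] = setT)//; apply/seteqP; split.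
rewrite cell_consE; apply: measurableI => //.
have mB : measurable (B (size w) : set (borel X)) by exact: open_borel.
case: b.
  by congr (measurable _): mB; apply/seteqP; split=> x /=; move/asboolP.
have := measurableC mB; congr (measurable _).
by apply/seteqP; split=> x /=; [move=> nB; apply/negbTE/asboolPn|move/negbT/asboolPn].
Qed.

Lemma measure_cell_cons (mu : probability (borel X) R) w :
  fine (mu (cell w)) = fine (mu (cell (true :: w))) + fine (mu (cell (false :: w))).
Proof.
rewrite cell_split measureU; [|exact: measurable_cell..|].
  by rewrite fineD// fin_num_measure//; exact: measurable_cell.
rewrite !cell_consE -subset0 => x [] [_ /= ->] [_ ]; discriminate.
Qed.

Lemma itinerary_mem j x y k : (j < k)%N -> itinerary x k = itinerary y k ->
  B j x -> B j y.
Proof.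
elim: k => // k IH; rewrite ltnS leq_eqVlt => /predU1P[->|jk] /= [bE wE].
  by move/asboolP; rewrite bE => /asboolP.
exact: IH.
Qed.

(** The common itinerary records membership in a small set [B j], which therefore contains both
    points. *)
Lemma cell_diam (e : R) N k : (forall x, exists j,
      [/\ (j < N)%N, B j x & forall y z, B j y -> B j z -> mdist y z < e]) ->
  (N <= k)%N -> forall x y, itinerary x k = itinerary y k -> mdist x y < e.
Proof.
move=> hN Nk x y xy; have [j [jN Bx Be]] := hN x.
by apply: Be => //; apply: itinerary_mem xy Bx; exact: leq_trans jN Nk.
Qed.

End Cells.

(** * Sequential compactness of the weak* topology *)

Section PushforwardProbability.
Context {R : realType} d (T : measurableType d) (X : pmetricType R).

(** Serves both to build a limit measure from Lebesgue measure and to push measures forward by the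
    dynamics. *)
Lemma probability_image (Q : probability T R) (Z : T -> X) :
  compact [set: X] -> measurable_fun setT (Z : T -> borel X) ->
  exists mu : probability (borel X) R,
    (forall A : set (borel X), measurable A -> mu A = Q (Z @^-1` A)) /\
    (forall g : X -> R, continuous g -> \int[mu]_x g x = \int[Q]_t g (Z t)).
Proof.
move=> cptX mZ.
pose mf := MeasurableFun.Pack (MeasurableFun.Class (isMeasurableFun.Build _ _ _ _ _ mZ)).
exists (distribution Q mf); split => // g cg.
rewrite /Rintegral; congr fine.
rewrite (@integral_pushforward _ _ _ _ _ _ mZ Q setT (EFin \o g)) ?preimage_setT//.
  by apply/measurable_EFinP; exact: continuous_borel.
have [M gM] := continuous_bounded cptX cg.
apply: (@measurable_bounded_integrable _ _ _ _ (g \o Z)) => //.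
- by rewrite (le_lt_trans (probability_le1 Q _)) ?ltry.
- exact: (measurableT_comp (continuous_borel cg) mZ).
- exists M; split; first exact: num_real.
  by move=> N /ltW MN x _; exact: le_trans (gM _) MN.
Qed.

End PushforwardProbability.

Section SequentialCompactness.
Context {R : realType} {X : pmetricType R}.
Hypothesis cptX : compact [set: X].

Lemma itinerary_take (B : nat -> set X) x y k k' : (k <= k')%N ->
  itinerary B x k' = itinerary B y k' -> itinerary B x k = itinerary B y k.
Proof.
move=> /subnK <-; elim: (k' - k)%N => //= j IH [_]; exact: IH.
Qed.

(* The points [Y k] with a prescribed itinerary of length [k] form a Cauchy
   sequence because the cells shrink uniformly. *)
Lemma shrinking_limit (B : nat -> set X) (Y : nat -> X) :
  (forall e : R, 0 < e -> exists N, forall x, exists j,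
    [/\ (j < N)%N, B j x & forall y z, B j y -> B j z -> mdist y z < e]) ->
  (forall k k', (k <= k')%N -> itinerary B (Y k') k = itinerary B (Y k) k) ->
  exists z, forall (e : R) N, 0 < e -> (forall x, exists j,
    [/\ (j < N)%N, B j x & forall y z, B j y -> B j z -> mdist y z < e]) ->
    forall k, (N <= k)%N -> mdist (Y k) z < e + e.
Proof.
move=> hB hY.
have [|z [_ clz]] := cptX (_ : ProperFilter (Y @ \oo)) _; first exact: filterT.
exists z => e N e0 hN k Nk.
have [_ [[k' /= kk' <-] zk']] := clz [set Y n | n in [set n | (k <= n)%N]] _
  (ex_intro2 _ _ k Logic.I (fun n kn => ex_intro2 _ _ n kn erefl)) (nbhsx_ballx z e e0).
move: zk'; rewrite ballEmdist/= metric_sym => zk'.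
apply: le_lt_trans (metric_triangle _ (Y k') _) _; rewrite ltrD//.
by apply: (cell_diam hN (leqnn N)); apply: itinerary_take Nk _; rewrite hY.
Qed.

(** The limits [p w] of the masses of cells are additive, so they define an interval coding.
    Integrals against [mu_ n] and against the image measure are both within e/3 of sums over words
    of length k, uniformly in n, and these sums converge. *)
Lemma weak_limit_point (mu_ : nat -> probability (borel X) R) :
  exists (sigma : nat -> nat) (mu : probability (borel X) R),
    (forall n, (sigma n < sigma n.+1)%N) /\
    forall g : X -> R, continuous g ->
      \int[mu_ (sigma n)]_x g x @[n --> \oo] --> \int[mu]_x g x.
Proof.
have [B [oB hB]] := refining_balls cptX.
have [sigma [p [sinc sp]]] : exists (sigma : nat -> nat) (p : seq bool -> R),
    (forall n, (sigma n < sigma n.+1)%N) /\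
    forall w, fine (mu_ (sigma n) (cell B w)) @[n --> \oo] --> p w.
  apply: (@bounded_family_subsequence _ _ (fun n w => fine (mu_ n (cell B w)))).
  move=> n w; have mw : measurable (cell B w) by exact: measurable_cell.
  rewrite fine_ge0//= -lee_fin fineK ?fin_num_measure//.
  exact: probability_le1.
have p_nil : p [::] = 1.
  apply: (cvg_unique _ (sp [::])); first exact: Rhausdorff.
  rewrite (_ : (fun _ => _) = cst 1); first exact: cvg_cst.
  apply/funext => n /=; rewrite -[RHS]/(fine 1) -(probability_setT (mu_ (sigma n))).
  by congr (fine (mu_ _ _)); apply/seteqP; split.
have p_ge0 w : 0 <= p w.
  rewrite -(cvg_lim (@Rhausdorff R) (sp w)); apply: limr_ge; first exact: cvgP (sp w).
  by apply: nearW => n; rewrite fine_ge0.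
have p_cons w : p w = p (true :: w) + p (false :: w).
  have E : (fun n => fine (mu_ (sigma n) (cell B w))) = (fun n =>
      fine (mu_ (sigma n) (cell B (true :: w))) +
      fine (mu_ (sigma n) (cell B (false :: w)))).
    by apply/funext => n; exact: measure_cell_cons.
  have := sp w; rewrite E => h.
  apply: (cvg_unique _ h); first exact: Rhausdorff.
  exact: cvgD.
(* An empty cell has measure 0 throughout, so words of positive limit mass have nonempty cells; only
   such words occur as codes. *)
have p_gt0 w : 0 < p w -> cell B w !=set0.
  move=> pw; apply/set0P/eqP => w0; move: pw.
  suff -> : p w = 0 by rewrite ltxx.
  apply: (cvg_unique _ (sp w)); first exact: Rhausdorff.
  rewrite w0 (_ : (fun _ => _) = cst 0); first exact: cvg_cst.
  apply/funext => n; rewrite -[RHS]/(fine 0); congr fine; exact: measure0.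
pose y w := xget point (cell B w).
have yP w : cell B w !=set0 -> cell B w (y w).
  by move=> [x wx]; exact: (xgetPex _ (ex_intro _ x wx)).
pose Y k s := y (code p (clamp s) k).
have YP k s : itinerary B (Y k s) k = code p (clamp s) k.
  have := yP _ (p_gt0 _ (p_code_clamp_gt0 p_nil p_ge0 p_cons s k)).
  by rewrite /cell/= size_code.
have Ynest s k k' : (k <= k')%N -> itinerary B (Y k' s) k = itinerary B (Y k s) k.
  move=> /subnK <-; rewrite YP.
  have : itinerary B (Y (k' - k + k) s)%N (k' - k + k) =
      code p (clamp s) (k' - k + k) by rewrite YP.
  move: (Y _ s) => x; elim: (k' - k)%N => //= j IH [_]; exact: IH.
have /choice[Z ZP] s := shrinking_limit hB (Ynest s).
have mcode := measurable_code_clamp p.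
have mZ : measurable_fun setT (Z : measurableTypeR R -> borel X).
  apply: borel_measurable_fun_continuous => g cg.
  apply: (measurable_fun_cvg (h := fun k s => g (Y k s))).
    move=> k _ V mV; rewrite setTI.
    (* For fixed [k] the point [Y k s] depends only on the code of [s], so this is a finite union of
       code sets. *)
    rewrite (_ : _ @^-1` _ = \bigcup_(w in [set: k.-tuple bool])
        ([set s | code p (clamp s) k = w] `&` [set _ | V (g (y w))])).
      apply: fin_bigcup_measurable => // w _; apply: measurableI; first exact: mcode.
      have [Vw|Vw] := pselect (V (g (y w))).
        by rewrite (_ : [set _ | _] = setT)//; apply/seteqP; split.
      by rewrite (_ : [set _ | _] = set0)//; apply/seteqP; split.
    apply/seteqP; split=> s /= => [Vs|[w _ [<- //]]].
    by exists (Tuple (introT eqP (size_code p (clamp s) k))).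
  move=> s _; apply/cvgrPdist_lt => e e0.
  have [d d0 gd] := continuous_uniform cptX cg e0.
  have d20 : 0 < d / 2 by rewrite divr_gt0.
  have [N hN] := hB _ d20.
  exists N => // k /= Nk; apply: gd; rewrite metric_sym [d]splitr.
  exact: (ZP s _ _ d20 hN).
have [mu [_ muZ]] := probability_image (@unit_lebesgue R) cptX mZ.
exists sigma, mu; split => // g cg.
apply/cvgrPdist_lt => e e0; rewrite (muZ g cg).
have e30 : 0 < e / 3 by rewrite divr_gt0.
have [d d0 gd] := continuous_uniform cptX cg e30.
have d20 : 0 < d / 2 by rewrite divr_gt0.
have [k hk] := hB _ d20.
have [M gM] := continuous_bounded cptX cg.
have mg := continuous_borel cg.
pose v (w : k.-tuple bool) := g (y w).
(* The point [Z s] may lie outside the cell of its code, since cells need not be closed, but it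
   stays within [d] of [Y k s]. *)
have h1 : `|\int[unit_lebesgue]_s g (Z s) - \sum_w v w * p w| <= e / 3.
  have lE (w : k.-tuple bool) :
      fine (unit_lebesgue [set s | code p (clamp s) k = w]) = p w.
    by have := unit_lebesgue_code p_nil p_ge0 p_cons w; rewrite size_tuple => ->.
  under eq_bigr do rewrite -lE.
  apply: (@integral_cells R _ _ (@unit_lebesgue R) (k.-tuple bool)
    (fun w => [set s | code p (clamp s) k = w]) (g \o Z) v _ M) => //.
  - exact: (measurableT_comp mg mZ).
  - by move=> t; exact: gM.
  - by move=> s; exists (Tuple (introT eqP (size_code p (clamp s) k))).
  - by move=> u w s us ws; apply/val_inj; rewrite /= -us -ws.
  - move=> w s /= ws; rewrite ltW// /v -ws -/(Y k s); apply: gd.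
    by rewrite metric_sym [d]splitr; exact: (ZP s _ _ d20 hk).
have h2 n : `|\int[mu_ n]_x g x -
    \sum_w v w * fine (mu_ n (cell B (w : k.-tuple bool)))| <= e / 3.
  apply: (@integral_cells R _ _ (mu_ n) _ (fun w : k.-tuple bool => cell B w) g v _ M) => //.
  - by move=> w; exact: measurable_cell.
  - move=> x; exists (Tuple (introT eqP (size_itinerary B x k))).
    exact: cell_itinerary.
  - by move=> u w x ux wx; apply/val_inj/(cell_uniq _ ux wx); rewrite !size_tuple.
  - move=> w x wx; rewrite ltW//; apply: gd.
    have wy := yP _ (ex_intro _ x wx).
    apply: (@lt_trans _ _ (d / 2)); last by lra.
    apply: (cell_diam hk (leqnn k)); move: wx wy.
    by rewrite /cell/= size_tuple => -> ->.
have h3 : \sum_w v w * fine (mu_ (sigma n) (cell B (w : k.-tuple bool))) @[n --> \oo] -->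
    \sum_w v w * p w.
  by apply: cvg_big => [|w _]; [exact: add_continuous|apply: cvgMr; exact: sp].
have tri (a b c c' : R) : `|c - a| <= e / 3 -> `|c' - b| <= e / 3 ->
    `|a - b| < e / 3 -> `|c - c'| < e.
  rewrite !ler_norml !ltr_norml => /andP[? ?] /andP[? ?] /andP[? ?].
  by apply/andP; split; lra.
near=> n; apply: tri h1 (h2 _) _.
by near: n; move/cvgrPdist_lt : h3; exact.
Unshelve. all: by end_near. Qed.

End SequentialCompactness.

Lemma ptws_cvgP (U : choiceType) (V : uniformType) (F : set_system {ptws U -> V})
    (h : U -> V) :
  Filter F -> {ptws, F --> h} <-> forall t, g t @[g --> F] --> h t.
Proof. exact: (@pointwise_cvgP (discrete_topology U) V F h). Qed.

(** * Weak* convergence of sequences and invariance of limits *)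

Section WeakStarConvergence.
Context {R : realType} {X : pmetricType R}.
Implicit Types (mu nu : probability (borel X) R).

Lemma weak_cvgP (nu_ : nat -> probability (borel X) R) mu :
  nu_ @ \oo --> mu <->
  forall g : X -> R, continuous g ->
    \int[nu_ n]_x g x @[n --> \oo] --> \int[mu]_x g x.
Proof.
split=> [numu g cg|H].
  pose g' : continuousType X R := mkcts cg.
  have h : integrals (nu_ n) @[n --> \oo] --> integrals mu.
    apply: continuous_cvg numu; exact: (@initial_continuous _ _ (@integrals R X)).
  exact: cvg_comp h (@proj_continuous _ _ g' (integrals mu)).
have h : integrals (nu_ n) @[n --> \oo] --> (integrals mu).
  by apply/ptws_cvgP => g; apply: H; exact: cts_fun.
move=> A [_ [[C oC <-] Cmu CA]].
have : nbhs (integrals mu) C by exact: open_nbhs_nbhs.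
by move=> /h[N _ hN]; exists N => // n Nn; apply: CA; exact: hN.
Qed.

(** Truncated multiples of the distance to the complement increase to the indicator; for the whole
    space, where this distance is 0 by default, the constant 1 is taken. *)
Lemma open_measure_limit (U : set X) : open U ->
  exists g : nat -> X -> R, [/\ forall n, continuous (g n),
    forall n x, `|g n x| <= 1 &
    forall x, g n x @[n --> \oo] --> (\1_U x : R)].
Proof.
move=> oU; have [UT|/set0P CU] := eqVneq (~` U) set0.
  have -> : U = setT by rewrite -[U]setCK UT setC0.
  exists (fun _ _ => 1); split => [n|n x|x]; first exact: cst_continuous.
    by rewrite normr1.
  by rewrite indicT; exact: cvg_cst.
have cU := open_closedC oU.
exists (fun n x => Num.min 1 (n%:R * infd (~` U) x)); split => [n x|n x|x].
- apply: (@continuous_min _ _ (cst 1) (fun x => n%:R * infd (~` U) x)).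
    exact: cvg_cst.
  by apply: cvgMr; exact: infd_continuous.
- rewrite ger0_norm ?ge_min ?lexx//.
  by rewrite le_min ler01 mulr_ge0// infd_ge0.
- rewrite indicE; have [Ux|nUx] := pselect (U x); last first.
    rewrite memNset// infd_eq0//; under eq_fun do rewrite mulr0 min_r//.
    exact: cvg_cst.
  rewrite mem_set//=.
  have d0 := infd_gt0 cU CU (fun h => h Ux).
  apply: cvg_near_cst; exists (Num.truncn (infd (~` U) x)^-1).+1 => // n /= dn.
  rewrite min_l// -ler_pdivrMr// div1r ltW// (lt_le_trans (truncnS_gt _))//.
  by rewrite ler_nat.
Qed.

(** Dominated convergence transfers equality of integrals to open sets, which generate the Borel
    sets and are stable under intersection. *)
Lemma measure_eq_integrals mu nu : compact [set: X] ->
  (forall g : X -> R, continuous g -> \int[mu]_x g x = \int[nu]_x g x) ->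
  forall A : set (borel X), measurable A -> mu A = nu A.
Proof.
move=> cptX munu.
have fin_ (m : probability (borel X) R) : (m [set: borel X] < +oo)%E.
  by rewrite (le_lt_trans (probability_le1 m _)) ?ltry.
have openE (U : set X) : open U -> mu U = nu U.
  move=> oU; have [g [cg g1 gU]] := open_measure_limit oU.
  have H (m : probability (borel X) R) :
      (\int[m]_x (g n x)%:E)%E @[n --> \oo] --> m (U : set (borel X)).
    have mU : measurable (U : set (borel X)) by exact: open_borel.
    have -> : m (U : set (borel X)) = (\int[m]_x (\1_(U : set (borel X)) x)%:E)%E.
      by rewrite integral_indic// setIT.
    have [] := @dominated_convergence _ _ _ m setT measurableT
      (fun n x => (g n x)%:E) (fun x => (\1_U x)%:E) (cst 1%E) => //.
    - by move=> n; apply/measurable_EFinP; exact: continuous_borel.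
    - apply/measurable_EFinP; exact: measurable_indic.
    - by apply: aeW => x _; apply/fine_cvgP; split; [exact: nearW|exact: gU].
    - apply: (@measurable_bounded_integrable _ _ _ _ (cst 1)) => //.
        exact: fin_.
      by exists 1; split => // N /ltW N1 x _; apply: le_trans N1; rewrite normr1.
    - by apply: aeW => x n _; rewrite lee_fin.
  apply: (cvg_unique _ (H mu)); first exact: ereal_hausdorff.
  rewrite (_ : (fun _ => _) = (fun n => (\int[nu]_x (g n x)%:E)%E)); first exact: H.
  apply/funext => n; have i m := continuous_integrable cptX m (cg n).
  rewrite -(fineK (integrable_fin_num _ (i mu)))//.
  by rewrite -(fineK (integrable_fin_num _ (i nu)))//; congr EFin; exact: munu.
apply: (@measure_unique _ R (borel X) (@open X) (fun=> setT) erefl _ _ _ mu nu) => //.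
- by move=> U V oU oV; exact: openI.
- by move=> _; exact: openT.
- by apply/seteqP; split => // x _; exists 0%N.
- by move=> _; exact: fin_.
Qed.

(** The image of [mu] under [f] has the same integrals as [mu], because [g \o f] is again a
    continuous test function. *)
Lemma invariant_weak_limit (f : X -> X) (nu_ : nat -> probability (borel X) R) mu :
  compact [set: X] -> continuous f -> (forall n, invariant_measures f (nu_ n)) ->
  (forall g : X -> R, continuous g ->
    \int[nu_ n]_x g x @[n --> \oo] --> \int[mu]_x g x) ->
  invariant_measures f mu.
Proof.
move=> cptX cf nu_inv numu A mA.
have mf := continuous_borel_map cf.
have [muf [mufE mufI]] := probability_image mu cptX mf.
rewrite -mufE//; apply: measure_eq_integrals => // g cg.
rewrite mufI//.
have cgf : continuous (g \o f).
  by move=> x; apply: continuous_comp; [exact: cf|exact: cg].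
apply: (cvg_unique _ (numu _ cgf)); first exact: Rhausdorff.
rewrite (_ : (fun _ => _) = (fun n => \int[nu_ n]_x g x)); first exact: numu.
apply/funext => n; have [nf [nfE nfI]] := probability_image (nu_ n) cptX mf.
rewrite -nfI// /Rintegral; congr fine; apply: eq_measure_integral => E mE _.
by rewrite -[RHS](nu_inv n E mE); exact: nfE.
Qed.

End WeakStarConvergence.

(** * Rotation vectors of ground states *)

Section RowVectors.
Context {R : realType} {m : nat}.
Implicit Types (u v w : 'rV[R]_m).

Lemma norm_rV_le u (M : R) : 0 <= M -> (forall i, `|u 0 i| <= M) -> `|u| <= M.
Proof.
move=> M0 uM; rewrite /Num.norm/= mx_normrE; apply: bigmax_le => // -[i j] _ /=.
by rewrite (ord1 i).
Qed.

Lemma cvg_rVP (u_ : nat -> 'rV[R]_m) v :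
  (forall i, u_ n 0 i @[n --> \oo] --> v 0 i) -> u_ n @[n --> \oo] --> v.
Proof.
move=> uv; apply/cvgrPdist_le => e e0.
have : \forall n \near \oo, forall i, `|v 0 i - u_ n 0 i| <= e.
  by apply: filter_forall => i; move/cvgrPdist_le : (uv i); exact.
apply: filterS => n h; apply: norm_rV_le (ltW e0) _ => i.
by rewrite !mxE; exact: h.
Qed.

End RowVectors.

Lemma cvg_subsequence (tau : nat -> nat) (T : Type) (u : nat -> T) (F : set_system T) :
  (forall n, (tau n < tau n.+1)%N) -> u n @[n --> \oo] --> F ->
  u (tau n) @[n --> \oo] --> F.
Proof.
move=> /increasing_ge_id tn ul A /ul[N _ hN]; exists N => // n /= Nn.
by apply: hN => /=; exact: leq_trans Nn (tn n).
Qed.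

Lemma increasing_subsequence (R : realType) (u : nat -> R) : u @ \oo --> +oo ->
  exists tau : nat -> nat, (forall n, (tau n < tau n.+1)%N) /\ increasing_seq (u \o tau).
Proof.
move=> uoo; have /choice[h hP] : forall n, exists k, (n < k)%N /\ u n < u k.
  move=> n; near \oo => k; exists k; split; first by near: k; exact: nbhs_infty_gt.
  by near: k; move/cvgryPgt : uoo; exact.
exists (fun n => iter n h 0%N); split=> [n|]; first by have [] := hP (iter n h 0%N).
by apply/increasing_seqP => n /=; have [] := hP (iter n h 0%N).
Unshelve. all: by end_near. Qed.

Section RotationVectors.
Context {R : realType} {X : pmetricType R} {m : nat}.
Variables (f : X -> X) (Phi : X -> 'rV[R]_m) (alpha : 'rV[R]_m).
Hypotheses (cptX : compact [set: X]) (cf : continuous f) (cPhi : continuous Phi).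
Implicit Types mu nu : probability (borel X) R.

Let phi := direction_potential alpha Phi.

Lemma coord_Phi_continuous i : continuous (fun x => Phi x 0 i).
Proof. move=> x; apply: (@continuous_comp _ _ _ Phi (fun M : 'rV[R]_m => M 0 i)).
  exact: cPhi.
exact: coord_continuous. Qed.

Lemma direction_potential_continuous : continuous phi.
Proof.
move=> x; rewrite /phi /direction_potential /dot.
apply: cvg_big => [|i _]; first exact: add_continuous.
by apply: cvgMr; exact: coord_Phi_continuous.
Qed.

Lemma rv_cvg (nu_ : nat -> probability (borel X) R) mu :
  (forall g : X -> R, continuous g ->
    \int[nu_ n]_x g x @[n --> \oo] --> \int[mu]_x g x) ->
  rv Phi (nu_ n) @[n --> \oo] --> rv Phi mu.
Proof.
move=> numu; apply: cvg_rVP => i; rewrite mxE; under eq_fun do rewrite mxE.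
by apply: numu; exact: coord_Phi_continuous.
Qed.

Lemma dot_rv mu : dot alpha (rv Phi mu) = \int[mu]_x phi x.
Proof.
rewrite /phi /direction_potential /dot.
rewrite (proj2 (Rintegral_sum _ measurableT _)); last first.
  move=> i; apply: continuous_integrable => // x.
  by apply: cvgMr; exact: coord_Phi_continuous.
apply: eq_bigr => i _; rewrite mxE RintegralZl//.
by apply: continuous_integrable => //; exact: coord_Phi_continuous.
Qed.

Lemma rv_bounded : exists M, forall mu, `|rv Phi mu| <= M.
Proof.
have /choice[M MP] i := continuous_bounded cptX (@coord_Phi_continuous i).
pose N := \sum_i `|M i|.
exists N => mu; apply: norm_rV_le; first exact: sumr_ge0.
move=> i; rewrite mxE; apply: (@le_trans _ _ (M i)).
  by apply: norm_Rintegral_le => //; exact: coord_Phi_continuous.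
rewrite (le_trans (ler_norm _))// /N (bigD1 i)//= lerDl; exact: sumr_ge0.
Qed.

(** Uniqueness of an equilibrium state is equality on Borel sets only; this suffices for rotation
    vectors. *)
Lemma eq_rv mu nu : (forall A : set (borel X), measurable A -> mu A = nu A) ->
  rv Phi mu = rv Phi nu.
Proof.
move=> munu; apply/rowP => i; rewrite !mxE /Rintegral; congr fine.
by apply: eq_measure_integral => A mA _; exact: munu.
Qed.

Lemma Rintegral_scale mu (t : R) : \int[mu]_x (t * phi x) = t * \int[mu]_x phi x.
Proof.
rewrite RintegralZl//; apply: continuous_integrable => //.
exact: direction_potential_continuous.
Qed.

Local Notation ES t := (equilibrium_states f (fun x => t * phi x)).

(* Unlike in the definition of a ground state, no weak* limit appears on the
   right-hand side: sequential compactness supplies it. *)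
Lemma rv_GSP w : [set rv Phi mu | mu in GS f Phi alpha] w <->
  forall e M : R, 0 < e -> exists s nu, [/\ M <= s, ES s nu & `|w - rv Phi nu| < e].
Proof.
split=> [[mu [mu_inv [t [nu_ [tinc too es numu]]]] <-] e M e0|H].
  have /cvgrPdist_lt/(_ e e0) := rv_cvg (iffLR (weak_cvgP _ _) numu).
  move=> rvn; near \oo => n; exists (t n), (nu_ n); split => //; last by near: n.
  by near: n; move/cvgryPge : too; exact.
have /choice[sn snP] : forall n : nat, exists p : R * probability (borel X) R,
    [/\ n%:R <= p.1, ES p.1 p.2 & `|w - rv Phi p.2| < n.+1%:R^-1].
  move=> n; have [|s [nu [h1 h2 h3]]] := H n.+1%:R^-1 n%:R; first by rewrite invr_gt0.
  by exists (s, nu).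
have [sigma [mu [sinc sigmu]]] := weak_limit_point cptX (fun n => (sn n).2).
have soo : (sn (sigma n)).1 @[n --> \oo] --> +oo.
  apply/cvgryPge => A; near=> n.
  have [h _ _] := snP (sigma n); apply: le_trans h.
  apply: (@le_trans _ _ n%:R); last by rewrite ler_nat; exact: increasing_ge_id.
  by near: n; exact: nbhs_infty_ger.
(* The times tend to infinity but need not be monotone, so a second extraction makes them
   increasing. *)
have [tau [tauinc sinc']] := increasing_subsequence soo.
have inv_ n : invariant_measures f (sn n).2 by have [_ []] := snP n.
exists mu; last first.
  apply: (@cvg_unique _ (@norm_hausdorff _ 'rV[R]_m) _ _ _ _ (rv_cvg sigmu)).
  apply/cvgrPdist_lt => e e0; near=> n.
  have [_ _ h] := snP (sigma n); apply: lt_trans h _.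
  apply: (@le_lt_trans _ _ n.+1%:R^-1).
    by rewrite lef_pV2 ?posrE// ler_nat ltnS; exact: increasing_ge_id.
  by near: n; exact: near_infty_natSinv_lt (PosNum e0).
split.
  by apply: invariant_weak_limit sigmu => // n; exact: inv_.
exists (fun n => (sn (sigma (tau n))).1), (fun n => (sn (sigma (tau n))).2); split => //.
- exact: (cvg_subsequence tauinc soo).
- by move=> n; have [_ ? _] := snP (sigma (tau n)).
- apply/weak_cvgP => g cg; exact: (cvg_subsequence tauinc (sigmu g cg)).
Unshelve. all: by end_near. Qed.

(** Closedness follows from [rv_GSP]: an approximation to within e/2 of a point at distance below
    e/2 from [w] approximates [w] to within [e]. *)
Lemma compact_rv_GS : compact [set rv Phi mu | mu in GS f Phi alpha].
Proof.
have [M rvM] := rv_bounded.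
apply: bounded_closed_compact.
  exists M; split; first exact: num_real.
  by move=> N /ltW MN _ [mu _ <-]; exact: le_trans (rvM mu) MN.
move=> w clw; apply/rv_GSP => e A e0.
have e20 : 0 < e / 2 by rewrite divr_gt0.
have [w' [/rv_GSP/(_ (e / 2) A e20)[s [nu [As es w'nu]]]]] :=
  clw _ (nbhsx_ballx w (e / 2) e20).
rewrite -ball_normE/= => ww'; exists s, nu; split => //.
by rewrite -(subrKA w') (le_lt_trans (ler_normD _ _))// [e]splitr ltrD.
Qed.

End RotationVectors.

(** * Connectedness of the limit set of a bounded curve *)

Section OmegaLimit.
Context {R : realType} {m : nat}.

(** A splitting of [K] into two closed pieces would give disjoint open neighbourhoods [U] and [V].
    Compactness keeps the curve eventually inside their union, while its connected tail comes close
    to both pieces. *)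
Lemma connected_omega_limit (gamma : R -> 'rV[R]_m) (T M : R) (K : set 'rV[R]_m) :
  {within `[T, +oo[, continuous gamma} -> (forall t, `|gamma t| <= M) -> closed K ->
  (forall w, K w <-> forall e A : R, 0 < e -> exists t,
     [/\ A <= t, T <= t & `|w - gamma t| < e]) ->
  connected K.
Proof.
move=> cgam gM cK KP B [b Bb] [C oC BC] [D cD BD].
apply: contrapT => BK.
have [w [Kw nBw]] : exists w, K w /\ ~ B w.
  apply: contrapT => h; apply: BK; apply/seteqP; split=> [x|x Kx].
    by rewrite BC => -[].
  by apply: contrapT => nBx; apply: h; exists x.
have cB : closed B by rewrite BD; exact: closedI.
have cKB : closed (K `&` ~` C) by apply: closedI => //; exact: open_closedC.
have dis : B `&` (K `&` ~` C) = set0.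
  by rewrite BC -subset0 => x [[_ Cx] [_ /(_ Cx)]].
have [U [V [oU oV BU KV UV]]] :=
  (iffLR (@normal_openP R _) (@pseudometric_normal R _)) _ _ cB cKB dis.
have KUV : K `<=` U `|` V.
  move=> x Kx; have [Cx|nCx] := pselect (C x); first by left; apply: BU; rewrite BC.
  by right; exact: KV.
(* Otherwise the curve is outside both sets at arbitrarily late times; a cluster point of such
   positions lies in [K], hence in the open union, which is absurd. *)
have [A AP] : exists A, forall t, A <= t -> T <= t -> (U `|` V) (gamma t).
  apply: contrapT => nA.
  have /choice[t tP] : forall n : nat, exists t,
      [/\ n%:R <= t, T <= t & ~ (U `|` V) (gamma t)].
    move=> n; apply: contrapT => nt; apply: nA; exists n%:R => t nlet Tt.
    by apply: contrapT => UVt; apply: nt; exists t.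
  have cptM : compact [set v : 'rV[R]_m | `|v| <= M].
    apply: bounded_closed_compact.
      exists M; split; first exact: num_real.
      by move=> N /ltW MN v /= /le_trans; exact.
    apply: (@preimage_closed _ _ (fun v : 'rV[R]_m => `|v|) [set r | r <= M]).
      by move=> v _; exact: norm_continuous.
    exact: closed_le.
  have [|z [_ clz]] := cptM ((gamma \o t) @ \oo) _.
    by exists 0%N => // n _ /=; exact: gM.
  have Kz : K z.
    apply/KP => e E e0.
    have [k Ek] : exists k : nat, E <= k%:R.
      by exists (Num.truncn E).+1; rewrite ltW// truncnS_gt.
    have [_ [[n /= kn <-]]] := clz [set gamma (t n) | n in [set n | (k <= n)%N]] _
      (ex_intro2 _ _ k Logic.I (fun n kn => ex_intro2 _ _ n kn erefl))
      (nbhsx_ballx z e e0).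
    rewrite -ball_normE/= => zt; have [nt Tt _] := tP n; exists (t n); split => //.
    by rewrite (le_trans Ek)// (le_trans _ nt)// ler_nat.
  have oUV : open (U `|` V) by exact: openU.
  have [_ [[n _ <-]]] := clz [set gamma (t n) | n in [set: nat]] _
      (ex_intro2 _ _ 0%N Logic.I (fun n kn => ex_intro2 _ _ n Logic.I erefl))
      (open_nbhs_nbhs (conj oUV (KUV _ Kz))).
  by have [_ _] := tP n.
pose A' := Num.max A T; pose I0 := `[A', +oo[%classic : set R.
have cI0 : connected (gamma @` I0).
  apply: connected_continuous_connected.
    by apply/connected_intervalP; exact: interval_is_interval.
  apply: continuous_subspaceW cgam => t; rewrite /I0 /= !in_itv/= !andbT.
  by rewrite /A' ge_max => /andP[].
have visit (O : set 'rV[R]_m) x : open O -> O x -> K x -> exists2 t, I0 t & O (gamma t).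
  move=> oO Ox /KP Kx.
  have /nbhs_ballP[e /= e0 eO] : nbhs x O by exact: open_nbhs_nbhs.
  have [t [A't _ xt]] := Kx e A' e0; exists t.
    by rewrite /I0/= in_itv/= A't.
  by apply: eO; rewrite -ball_normE.
have Kb : K b by move: Bb; rewrite BC => -[].
have [t1 It1 Ut1] := visit U b oU (BU _ Bb) Kb.
have Vw : V w by apply: KV; split => // Cw; apply: nBw; rewrite BC.
have [t2 It2 Vt2] := visit V w oV Vw Kw.
have UVI t : I0 t -> (U `|` V) (gamma t).
  by rewrite /I0/= in_itv/= andbT /A' ge_max => /andP[? ?]; exact: AP.
(* The part of the tail in [U] is also relatively closed, being the part outside [V], so it is the
   whole tail. *)
have E : gamma @` I0 `&` U = gamma @` I0.
  apply: cI0.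
  - by exists (gamma t1); split => //; exists t1.
  - by exists U.
  - exists (~` V); first exact: open_closedC.
    apply/seteqP; split=> x [[t It <-]] h; split; try by exists t.
      by move=> Vx; rewrite -[False]/(set0 (gamma t)) -UV.
    by case: (UVI t It).
have : (gamma @` I0) (gamma t2) by exists t2.
rewrite -E => -[_ Ut2]; have : (U `&` V) (gamma t2) by split.
by rewrite UV.
Qed.

End OmegaLimit.

(** * Ground states *)

Section GroundStates.
Context {R : realType} {X : pmetricType R} {m : nat}.
Variables (f : X -> X) (Phi : X -> 'rV[R]_m) (alpha : 'rV[R]_m).
Hypotheses (cptX : compact [set: X]) (cf : continuous f) (cPhi : continuous Phi).
Hypothesis fin_htop : (topological_entropy f < +oo)%E.
Hypothesis usc_h : usc_entropy_map f.
Implicit Types mu nu : probability (borel X) R.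

Let phi := direction_potential alpha Phi.

Lemma ks_entropy_fin_num mu : invariant_measures f mu -> ks_entropy f mu \is a fin_num.
Proof.
have [C hC] := ks_entropy_bounded cptX cf fin_htop.
move=> /hC muC; rewrite ge0_fin_numE ?ks_entropy_ge0//.
exact: le_lt_trans muC (ltry _).
Qed.

Let entropy mu : R := fine (ks_entropy f mu).

Lemma equilibrium_le (t : R) mu nu : equilibrium_states f (fun x => t * phi x) mu ->
  invariant_measures f nu ->
  entropy nu + t * \int[nu]_x phi x <= entropy mu + t * \int[mu]_x phi x.
Proof.
move=> [mu_inv muP] nu_inv; have := muP nu nu_inv.
rewrite !(Rintegral_scale alpha cptX cPhi).
rewrite -(fineK (ks_entropy_fin_num nu_inv)) -(fineK (ks_entropy_fin_num mu_inv)).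
by rewrite -!EFinD lee_fin.
Qed.

(* Entropies are bounded, so the energy term dominates as [t] tends to infinity. *)
Lemma ground_state_maximizing mu nu : GS f Phi alpha mu -> invariant_measures f nu ->
  \int[nu]_x phi x <= \int[mu]_x phi x.
Proof.
move=> [mu_inv [t [mu_ [_ too es /weak_cvgP mumu]]]] nu_inv.
have [C hC] := ks_entropy_bounded cptX cf fin_htop.
have phimu := mumu _ (direction_potential_continuous cPhi (alpha := alpha)).
rewrite leNgt; apply/negP => lt_munu.
set d := \int[nu]_x phi x - \int[mu]_x phi x.
have dE : d = \int[nu]_x phi x - \int[mu]_x phi x by [].
have d0 : 0 < d by rewrite subr_gt0.
have d20 : 0 < d / 2 by rewrite divr_gt0.
near \oo => n.
(* Beyond this time an energy gap of d/2 outweighs any entropy gain, which is at most [C] because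
   entropies lie between 0 and [C]. *)
have tn : `|C| / (d / 2) < t n by near: n; move/cvgryPgt : too; exact.
have tn0 : 0 < t n by apply: le_lt_trans tn; rewrite divr_ge0// ltW.
have close : `|\int[mu]_x phi x - \int[mu_ n]_x phi x| < d / 2.
  by near: n; move/cvgrPdist_lt : phimu; exact.
have esn := es n; have [inv_n _] := esn.
have := equilibrium_le esn nu_inv.
have En : entropy (mu_ n) <= C.
  by rewrite -lee_fin fineK ?ks_entropy_fin_num//; exact: hC.
have E0 : 0 <= entropy nu by rewrite fine_ge0// ks_entropy_ge0.
have h : d / 2 <= \int[nu]_x phi x - \int[mu_ n]_x phi x.
  by move: close; rewrite ltr_norml => /andP[? ?]; lra.
have : `|C| < t n * (\int[nu]_x phi x - \int[mu_ n]_x phi x).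
  apply: (@lt_le_trans _ _ (t n * (d / 2))); first by rewrite -ltr_pdivrMr.
  by rewrite ler_wpM2l// ltW.
have := ler_norm C; rewrite mulrBr; lra.
Unshelve. all: by end_near. Qed.

Lemma rv_ground_state_face mu : GS f Phi alpha mu -> face f Phi alpha (rv Phi mu).
Proof.
move=> gs; have [mu_inv _] := gs.
have rot : rotation_set f Phi (rv Phi mu) by exists mu.
split => //; split; first by exists (rv Phi mu).
move=> _ [_ [nu nu_inv <-] <-]; rewrite !(dot_rv alpha cptX cPhi).
exact: ground_state_maximizing.
Qed.

(** A measure with rotation vector in the face has the largest integral, so the equilibrium
    inequality forces its entropy below that of each late [mu_ n]. A strict drop at the limit would
    contradict upper semi-continuity. *)
Lemma ground_state_entropy_ge mu nu : GS f Phi alpha mu -> invariant_measures f nu ->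
  face f Phi alpha (rv Phi nu) -> (ks_entropy f nu <= ks_entropy f mu)%E.
Proof.
move=> [mu_inv [t [mu_ [_ too es mumu]]]] nu_inv [_ [_ nu_max]].
have le_n n : 0 <= t n -> entropy nu <= entropy (mu_ n).
  move=> tn0; have esn := es n; have [inv_n _] := esn.
  have : \int[mu_ n]_x phi x <= \int[nu]_x phi x.
    rewrite -!(dot_rv alpha cptX cPhi); apply: nu_max.
    by exists (rv Phi (mu_ n)) => //; exists (mu_ n).
  move=> /(ler_wpM2l tn0); have := equilibrium_le esn nu_inv; lra.
rewrite leNgt; apply/negP; rewrite -(fineK (ks_entropy_fin_num nu_inv)).
move=> /(usc_h mu_inv)/mumu near_lt.
near \oo => n.
have tn0 : 0 <= t n by near: n; move/cvgryPge : too; exact.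
have esn := es n; have [inv_n _] := esn.
have : (ks_entropy f (mu_ n) < (entropy nu)%:E)%E.
  by move: inv_n; near: n; exact: near_lt.
rewrite -(fineK (ks_entropy_fin_num inv_n)) lte_fin ltNge => /negP; apply.
exact: le_n.
Unshelve. all: by end_near. Qed.

(** With unique equilibrium states, [rv_GSP] identifies the set with the limit points of the curve
    of rotation vectors as [t] tends to infinity. *)
Lemma connected_rv_GS (T : R) (mu_ : R -> probability (borel X) R) :
  (forall t, T <= t -> unique_equilibrium_state f (fun x => t * phi x) (mu_ t)) ->
  {within `[T, +oo[, continuous (fun t : R => rv Phi (mu_ t))} ->
  connected [set rv Phi mu | mu in GS f Phi alpha].
Proof.
move=> uniq_mu crv; have [M rvM] := rv_bounded cptX cPhi.
apply: (connected_omega_limit crv (M := M)) => [t||w]; first exact: rvM.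
  apply: compact_closed; first exact: norm_hausdorff.
  exact: compact_rv_GS.
split=> [/(rv_GSP alpha cptX cf cPhi) H e A e0|H].
  (* Asking for a time beyond [T] as well puts [s] in the range of uniqueness. *)
  have [s [nu [As es wnu]]] := H e (Num.max A T) e0.
  move: As; rewrite ge_max => /andP[As Ts]; exists s; split => //.
  by rewrite -(@eq_rv _ _ _ Phi nu (mu_ s))//; have [_] := uniq_mu s Ts; exact.
apply/(rv_GSP alpha cptX cf cPhi) => e A e0; have [t [At Tt wt]] := H e A e0.
by exists t, (mu_ t); split => //; have [] := uniq_mu t Tt.
Qed.

End GroundStates.

Theorem theoremA (R : realType) (X : pmetricType R) (f : X -> X) (m : nat)
    (Phi : X -> 'rV[R]_m) (alpha : 'rV[R]_m)
    (cptX : compact [set: X]) (cf : continuous f)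
    (fin_htop : (topological_entropy f < +oo)%E)
    (usc_h : usc_entropy_map f)
    (cPhi : continuous Phi) (alphaS : unit_sphere alpha) :
  (forall mu : probability (borel X) R, GS f Phi alpha mu ->
     face f Phi alpha (rv Phi mu) /\
     ks_entropy f mu =
       ereal_sup [set ks_entropy f nu | nu in
         [set nu : probability (borel X) R |
            invariant_measures f nu /\ face f Phi alpha (rv Phi nu)]])
  /\
  (compact [set rv Phi mu | mu in GS f Phi alpha] /\
   ((exists (T : R) (mu_ : R -> probability (borel X) R),
       (forall t : R, T <= t ->
          unique_equilibrium_state f
            (fun x => t * direction_potential alpha Phi x) (mu_ t)) /\
       {within `[T, +oo[, continuous (fun t : R => rv Phi (mu_ t))}) ->
    connected [set rv Phi mu | mu in GS f Phi alpha])).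
Proof.
split=> [mu gs|].
  have mu_face := rv_ground_state_face cptX cf cPhi fin_htop gs.
  split => //; apply/eqP; rewrite eq_le; apply/andP; split.
    by apply: ereal_sup_ubound; exists mu => //; split => //; have [] := gs.
  apply: ge_ereal_sup => _ [nu [nu_inv nu_face] <-].
  exact: (ground_state_entropy_ge cptX cf cPhi fin_htop usc_h gs).
split; first exact: compact_rv_GS.
by move=> [T [mu_ [uniq_mu crv]]]; exact: connected_rv_GS uniq_mu crv.
Qed.
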